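(* Let $f$ be a log-concave function on $\mathbb{R}^n$ with $0<\int f\,dx<\infty$ and with barycenter at the origin. Let $\mu=f\,d\mathrm{mes}_n$, let $\lambda$ be the restriction of Lebesgue measure to $K_f$, and let $T=T_f$ be the canonical radial map (so $T_*\mu=\lambda$). Define $u:\mathbb{R}^n\to[0,1]$ by $u(0)=0$ and $T(x)=u(x)\,\frac{x}{\|x\|_{K_f}}$ for $x\ne0$, i.e. $$u(x)=\Big(\frac{\int_0^1 r^{n-1}f(rx)\,dr}{\int_0^\infty r^{n-1}f(rx)\,dr}\Big)^{1/n}.$$ Then, as a function on the normed space $(\mathbb{R}^n,\|\cdot\|_{\widehat{K_f}})$, $$\|u\|_{\mathrm{Lip}}\ \le\ C\,f(0)^{1/n},$$ where $C>0$ is a universal constant.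
   Context: For an integrable $f\ge0$ on $\mathbb{R}^n$ set $\|x\|_{K_f}=\big(n\int_0^\infty f(rx)r^{n-1}\,dr\big)^{-1/n}$ and $K_f=\{x\in\mathbb{R}^n:\|x\|_{K_f}\le1\}$; for log-concave $f$ this is a convex body (not necessarily symmetric). Let $\widehat{K_f}=K_f\cap(-K_f)$, a symmetric convex body, and $\|\cdot\|_{\widehat{K_f}}$ its norm (Minkowski functional). The canonical radial map $T_f$ is defined by $T_f(0)=0$ and, for $x\neq0$, $T_f(x)=\Big(\frac{\int_0^1 f(rx)r^{n-1}dr}{\int_0^\infty f(rx)r^{n-1}dr}\Big)^{1/n}\frac{x}{\|x\|_{K_f}}$. The Lipschitz norm of $u$ is $\sup_{x\ne y}|u(x)-u(y)|/\|x-y\|_{\widehat{K_f}}$. *)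

(* Defs.v *)
From HB Require Import structures.
From mathcomp Require Import all_boot all_order all_algebra.
From mathcomp Require Import all_classical all_reals all_analysis.
Set Implicit Arguments. Unset Strict Implicit. Unset Printing Implicit Defensive.
Import Order.TTheory GRing.Theory Num.Theory.
Import numFieldNormedType.Exports.
Local Open Scope classical_set_scope.
Local Open Scope ring_scope.

Section Defs.
Variable R : realType.

(* Lebesgue integral over R^n of a nonnegative (extended-real valued) function,
   computed as the iterated one-dimensional Lebesgue integral (Tonelli). *)
Fixpoint iint (n : nat) : ('rV[R]_n -> \bar R) -> \bar R :=
  match n return ('rV[R]_n -> \bar R) -> \bar R with
  | 0 => fun g => g 0
  | n'.+1 => fun g =>
      (\int[@lebesgue_measure R]_(t in [set: R])
          iint (fun y : 'rV[R]_n' => g (row_mx (const_mx t : 'rV[R]_1) y)))%E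
  end.

Definition log_concave (n : nat) (f : 'rV[R]_n -> R) : Prop :=
  (forall x, 0 <= f x) /\
  forall (x y : 'rV[R]_n) (t : R), 0 <= t <= 1 ->
    f x `^ (1 - t) * f y `^ t <= f ((1 - t) *: x + t *: y).

(* barycenter at the origin: for each coordinate i, int x_i^+ f = int x_i^- f,
   both finite (i.e. int x_i f(x) dx = 0 with x_i f integrable) *)
Definition barycenter_origin (n : nat) (f : 'rV[R]_n -> R) : Prop :=
  forall i : 'I_n,
    (iint (fun x => (Num.max (x ord0 i) 0 * f x)%:E) < +oo)%E /\
    (iint (fun x => (Num.max (- x ord0 i) 0 * f x)%:E) < +oo)%E /\
    iint (fun x => (Num.max (x ord0 i) 0 * f x)%:E) =
    iint (fun x => (Num.max (- x ord0 i) 0 * f x)%:E).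

Definition radial_int (n : nat) (f : 'rV[R]_n -> R) (x : 'rV[R]_n)
  (A : set R) : \bar R :=
  (\int[@lebesgue_measure R]_(r in A) (r ^+ n.-1 * f (r *: x))%:E)%E.

Definition normK (n : nat) (f : 'rV[R]_n -> R) (x : 'rV[R]_n) : R :=
  if x == 0 then 0
  else (n%:R * fine (radial_int f x `[0, +oo[)) `^ (- (n%:R)^-1).

Definition Kf (n : nat) (f : 'rV[R]_n -> R) : set 'rV[R]_n :=
  [set x | normK f x <= 1].

Definition Khat (n : nat) (f : 'rV[R]_n -> R) : set 'rV[R]_n :=
  Kf f `&` [set x | Kf f (- x)].

Definition normKhat (n : nat) (f : 'rV[R]_n -> R) (z : 'rV[R]_n) : R :=
  inf [set t : R | 0 < t /\ Khat f (t^-1 *: z)].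

Definition u_radial (n : nat) (f : 'rV[R]_n -> R) (x : 'rV[R]_n) : R :=
  if x == 0 then 0
  else (fine (radial_int f x `[0, 1]) / fine (radial_int f x `[0, +oo[))
         `^ (n%:R)^-1.

End Defs.

(* Main.v *)
Require Import Defs.
From HB Require Import structures.
From mathcomp Require Import all_boot all_order all_algebra.
From mathcomp Require Import all_classical all_reals all_analysis.
From mathcomp Require Import measurable_realfun.
From mathcomp Require Import ring lra.
Set Implicit Arguments. Unset Strict Implicit. Unset Printing Implicit Defensive.
Import Order.TTheory GRing.Theory Num.Theory.
Import numFieldNormedType.Exports.
Local Open Scope classical_set_scope.
Local Open Scope ring_scope.

(* On each ray the paper's quantities are one-dimensional: with
   A x = int_0^1 r^(n-1) f(rx) dr and B x = int_0^oo r^(n-1) f(rx) dr one has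
   u^n = A / B and ||x||_K^(-n) = n B x.
   - The barycenter hypothesis gives f <= M^n f(0) with M universal. A
     subgradient b of -ln f at 0 yields f x <= f(0) e^(b.x); compare f, scaled by
     1 - 1/(n+1) towards a point p where f is large, with f itself and integrate:
     the first moment along b vanishes, and f p <= e^(O(n)) f(0) results.
   - A log-concave h <= M^n h(0) on [0, oo[ with (3 M rho)^n h(0) <= n int h r^(n-1)
     satisfies h(rho) >= h(0) e^(-2n), and its r-mean for the weight h r^(n-1) is
     at most a constant times the scale nu given by nu^n h(0) = n int h r^(n-1).
   - If x = y + e z and f(rho z) >= e^(-2n) f(0), put d = e / rho; then
     (s / (1 + d s)) x lies between s y and rho z. Log-concavity and the
     substitution r = s / (1 + d s) bound int h_x r^(n-1) from below by the
     integral of h_y r^(n-1) e^(-O(n d) r), and Jensen's inequality takes the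
     exponential out. Hence u x <= u y e^(O(d (1 + nu y))), while u y <= M / nu y;
     so u x - u y = O(d) when the exponent is small, and otherwise either d is
     bounded below or nu y is so large that u x itself is O(d).
   Taking z = (x - y) / t in the symmetrized body makes rho ~ f(0)^(-1/n). *)

(** * Separation *)

(** Since [u] is an [n]-th root, every factor e^(O(n)) costs only a constant; what must be kept is
    that the exponents are linear in [n * d]. The bound at [rho z] is needed for [z] and for [- z],
    because the numerator [A] is compared from [x] to [y] and the denominator [B] from [y] to [x];
    hence the symmetrized body. The technical obstacle is measurability. The integral over the space
    is iterated, and for a general integrand only its monotonicity is at hand, whereas the
    barycenter argument has to add integrals and rescale them. So [f] is replaced by its lower
    semicontinuous hull [lsc_hull f]. It has the same integral and the same first moments, because
    contracting slightly towards a box where [f] is bounded below turns a value of [f] into a lower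
    bound on a whole neighbourhood. The semicontinuity used, [box_lsc], passes to slices, and
    Fatou's lemma by induction on the dimension makes slice integrals measurable. Signed first
    moments are never formed: a linear functional is split into nonnegative parts [P] and [N] with
    equal finite integrals, which then cancel. *)

Definition sublinear (R : realType) (V : lmodType R) (p : V -> R) : Prop :=
  (forall x y, p (x + y) <= p x + p y) /\
  (forall (c : R) x, 0 < c -> p (c *: x) = c * p x).

Definition dotr (R : realType) (n : nat) (b x : 'rV[R]_n) : R :=
  \sum_i b ord0 i * x ord0 i.

Lemma sublinear0 (R : realType) (V : lmodType R) (p : V -> R) :
  sublinear p -> p 0 = 0.
Proof.
by move=> [_ pZ]; have := pZ 2 0 (ltr0Sn _ _); rewrite scaler0; lra.
Qed.

(** One step of Hahn-Banach: the infimum over [t >= 0] of [p (x + t v) - t p v] is bounded below by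
    [- p (- x)]. Since [q v <= p v], the last bound forces [q] to be linear on the line of [v]. *)
Lemma sublinear_straighten (R : realType) (V : lmodType R) (p : V -> R) (v : V) :
  sublinear p -> exists q : V -> R,
    [/\ sublinear q, forall x, q x <= p x & q (- v) <= - p v].
Proof.
move=> sp; have [pD pZ] := sp; have p0 := sublinear0 sp.
pose S x := [set p (x + t *: v) - t * p v | t in [set t : R | 0 <= t]].
have lbS x : lbound (S x) (- p (- x)).
  move=> _ [t /= t0 <-].
  have ptv : p (t *: v) = t * p v.
    move: t0; rewrite le_eqVlt => /predU1P[<-|t0]; last exact: pZ.
    by rewrite scale0r mul0r.
  have := pD (x + t *: v) (- x); rewrite addrAC subrr add0r ptv; lra.
have S0 x : S x !=set0 by exists (p (x + 0 *: v) - 0 * p v); exists 0 => /=.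
have hi x : has_inf (S x) by split => //; exists (- p (- x)).
have infle x t : 0 <= t -> inf (S x) <= p (x + t *: v) - t * p v.
  by move=> t0; apply: ge_inf; [case: (hi x)|exists t].
exists (fun x => inf (S x)); split.
- split=> [x y|c x c0].
    apply/ler_addgt0Pr => e e0.
    have e20 : 0 < e / 2 by rewrite divr_gt0.
    have [_ [s /= s0 <-] hs] := inf_adherent e20 (hi x).
    have [_ [t /= t0 <-] ht] := inf_adherent e20 (hi y).
    have st0 : 0 <= s + t by rewrite addr_ge0.
    have := infle (x + y) _ st0; have := pD (x + s *: v) (y + t *: v).
    rewrite addrACA -scalerDl; lra.
  have aux (a : R) y : 0 < a -> inf (S (a *: y)) <= a * inf (S y).
    move=> a0; apply/ler_addgt0Pr => e e0.
    have ea0 : 0 < e / a by rewrite divr_gt0.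
    have [_ [s /= s0 <-] hs] := inf_adherent ea0 (hi y).
    have as0 : 0 <= a * s by rewrite mulr_ge0// ltW.
    have := infle (a *: y) _ as0; rewrite -scalerA -scalerDr pZ// => h.
    have : a * (p (y + s *: v) - s * p v) < a * (inf (S y) + e / a).
      by rewrite ltr_pM2l.
    rewrite [X in _ < X]mulrDr [a * (e / a)]mulrC divfK ?gt_eqF//; lra.
  apply/le_anti; rewrite aux//=.
  have ci0 : 0 < c^-1 by rewrite invr_gt0.
  have := aux c^-1 (c *: x) ci0.
  by rewrite scalerA mulVf ?gt_eqF// scale1r ler_pdivlMl.
- by move=> x; have := infle x 0 (lexx _); rewrite scale0r addr0 mul0r subr0.
- by have := infle (- v) 1 ler01; rewrite scale1r addNr p0 mul1r sub0r.
Qed.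

(** Straightness along [w] survives any later decrease from [q] to [r]:
    [r (- w) <= q (- w) <= - p w <= - r w]. *)
Lemma sublinear_straighten_seq (R : realType) (V : lmodType R) (p : V -> R) (s : seq V) :
  sublinear p -> exists q : V -> R,
    [/\ sublinear q, forall x, q x <= p x & {in s, forall v, q (- v) <= - q v}].
Proof.
elim: s p => [|v s IH] p sp; first by exists p.
have [q [sq qp qv]] := sublinear_straighten v sp.
have [r [sr rq rs]] := IH q sq.
exists r; split=> // [x|w]; first exact: le_trans (qp x).
rewrite inE => /predU1P[->|/rs//].
by apply: le_trans (rq _) (le_trans qv _); rewrite lerN2 (le_trans (rq _))//.
Qed.

(** Straightening along [v] first secures the value at [v]; straightening along the canonical basis
    then makes the minorant linear, with coefficients its values on the basis. *)
Lemma hahn_banach_rV (R : realType) (n : nat) (p : 'rV[R]_n -> R) (v : 'rV[R]_n) :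
  sublinear p -> exists b : 'rV[R]_n,
    (forall x, dotr b x <= p x) /\ p v <= dotr b v.
Proof.
move=> sp; have [p' [sp' p'p p'v]] := sublinear_straighten v sp.
have [q [sq qp' qs]] := sublinear_straighten_seq
  [seq delta_mx 0 i | i <- enum 'I_n] sp'.
have [qD qZ] := sq; have q0 := sublinear0 sq.
pose b : 'rV[R]_n := \row_i q (delta_mx 0 i).
have qsum (r : seq 'I_n) (F : 'I_n -> 'rV[R]_n) :
    q (\sum_(i <- r) F i) <= \sum_(i <- r) q (F i).
  elim: r => [|i r IH]; first by rewrite !big_nil q0.
  by rewrite !big_cons (le_trans (qD _ _))// lerD2l.
have qe (c : R) i : q (c *: delta_mx 0 i) <= c * q (delta_mx 0 i).
  have [c0|c0|->] := ltgtP c 0; last by rewrite scale0r mul0r q0.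
    have -> : c *: delta_mx 0 i = (- c) *: - delta_mx 0 i :> 'rV[R]_n.
      by rewrite scaleNr scalerN opprK.
    rewrite qZ ?oppr_gt0// mulNr -mulrN ler_nM2l//.
    have : q (- delta_mx 0 i) <= - q (delta_mx 0 i).
      by apply: qs; apply/mapP; exists i; rewrite ?mem_enum.
    lra.
  by rewrite qZ.
have qb x : q x <= dotr b x.
  rewrite {1}(row_sum_delta x) (le_trans (qsum _ _))//.
  by apply: ler_sum => i _; rewrite mxE mulrC qe.
have dN x : dotr b (- x) = - dotr b x.
  by rewrite /dotr -sumrN; apply: eq_bigr => i _; rewrite [(- x) _ _]mxE mulrN.
have bq x : dotr b x <= q x.
  have := qb (- x); rewrite dN; have := qD x (- x); rewrite subrr q0; lra.
exists b; split=> [x|]; first exact: le_trans (bq _) (le_trans (qp' _) _).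
have := bq (- v); have := qp' (- v); rewrite dN; lra.
Qed.

(** The functional is dominated by the perspective, the infimum of [t * H (t^-1 *: x)] over [t > 0],
    which is sublinear. For [H] constant 1 this is the gauge of [S] and the result separates a point
    from [S]; for a convex [H] with [H 0 = 0] it gives a subgradient at the origin. *)
Lemma convex_hahn_banach (R : realType) (n : nat) (S : set 'rV[R]_n)
    (H : 'rV[R]_n -> R) (v : 'rV[R]_n) (k : R) :
  (forall x y w, S x -> S y -> 0 < w < 1 ->
     S (w *: x + (1 - w) *: y) /\
     H (w *: x + (1 - w) *: y) <= w * H x + (1 - w) * H y) ->
  (forall x, exists2 t, 0 < t & S (t^-1 *: x)) ->
  0 <= H 0 ->
  (forall t, 0 < t -> S (t^-1 *: v) -> k <= t * H (t^-1 *: v)) ->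
  exists b : 'rV[R]_n,
    (forall x, S x -> dotr b x <= H x) /\ k <= dotr b v.
Proof.
move=> cv ab H0 kv.
pose T x := [set t * H (t^-1 *: x) | t in [set t : R | 0 < t /\ S (t^-1 *: x)]].
have comb x y s t : 0 < s -> 0 < t -> S (s^-1 *: x) -> S (t^-1 *: y) ->
    S ((s + t)^-1 *: (x + y)) /\
    (s + t) * H ((s + t)^-1 *: (x + y)) <= s * H (s^-1 *: x) + t * H (t^-1 *: y).
  move=> s0 t0 Sx Sy; have st0 : 0 < s + t by rewrite addr_gt0.
  have w01 : 0 < s / (s + t) < 1.
    by rewrite divr_gt0//= ltr_pdivrMr// mul1r ltrDl.
  have wE : 1 - s / (s + t) = t / (s + t) by field; rewrite gt_eqF.
  have := cv _ _ _ Sx Sy w01; rewrite wE.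
  have -> : s / (s + t) *: (s^-1 *: x) + t / (s + t) *: (t^-1 *: y) =
      (s + t)^-1 *: (x + y).
    rewrite !scalerA scalerDr; congr (_ *: _ + _ *: _);
    by field; rewrite !gt_eqF.
  move=> [? h]; split=> //; rewrite -ler_pdivlMl//; apply: (le_trans h).
  by rewrite mulrDr !mulrA ![(s + t)^-1 * _]mulrC.
have T0 x : T x !=set0.
  by have [t t0 St] := ab x; exists (t * H (t^-1 *: x)); exists t.
(* Combining [x] with [- x] bounds the sum of the two perspective values below by a positive
   multiple of [H 0]. *)
have lbT x : has_lbound (T x).
  have [s s0 Ss] := ab (- x); exists (- (s * H (s^-1 *: (- x)))).
  move=> _ [t /= [t0 St] <-].
  have [_] := comb _ _ _ _ t0 s0 St Ss; rewrite subrr scaler0 => h.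
  have : 0 <= (t + s) * H 0 by rewrite mulr_ge0// ltW// addr_gt0.
  lra.
have hi x : has_inf (T x) by [].
pose p x := inf (T x).
have ple x t : 0 < t -> S (t^-1 *: x) -> p x <= t * H (t^-1 *: x).
  by move=> t0 St; apply: ge_inf; [exact: lbT|exists t].
have sp : sublinear p.
  split=> [x y|c x c0].
    apply/ler_addgt0Pr => e e0.
    have e20 : 0 < e / 2 by rewrite divr_gt0.
    have [_ [s /= [s0 Ss] <-] hs] := inf_adherent e20 (hi x).
    have [_ [t /= [t0 St] <-] ht] := inf_adherent e20 (hi y).
    have [Sst hst] := comb _ _ _ _ s0 t0 Ss St.
    have := ple (x + y) (s + t) (addr_gt0 s0 t0) Sst.
    rewrite -/(p x) -/(p y) in hs ht; lra.
  have aux (a : R) y : 0 < a -> p (a *: y) <= a * p y.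
    move=> a0; apply/ler_addgt0Pr => e e0.
    have ea0 : 0 < e / a by rewrite divr_gt0.
    have [_ [s /= [s0 Ss] <-] hs] := inf_adherent ea0 (hi y).
    have as0 : 0 < a * s by rewrite mulr_gt0.
    have E : (a * s)^-1 *: (a *: y) = s^-1 *: y.
      by rewrite scalerA; congr (_ *: _); field; rewrite !gt_eqF.
    have := ple (a *: y) _ as0; rewrite E => /(_ Ss) h.
    have : a * (s * H (s^-1 *: y)) < a * (p y + e / a).
      by rewrite ltr_pM2l.
    rewrite [X in _ < X]mulrDr [a * (e / a)]mulrC divfK ?gt_eqF//; lra.
  apply/le_anti; rewrite aux//=.
  have ci0 : 0 < c^-1 by rewrite invr_gt0.
  have := aux c^-1 (c *: x) ci0.
  by rewrite scalerA mulVf ?gt_eqF// scale1r ler_pdivlMl.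
have [b [bp bv]] := hahn_banach_rV v sp.
exists b; split=> [x Sx|].
  have := ple x 1 ltr01; rewrite invr1 scale1r mul1r => /(_ Sx).
  exact: le_trans.
apply: le_trans bv; apply: lb_le_inf => // _ [t /= [t0 St] <-]; exact: kv.
Qed.

(** * Iterated integrals of lower semicontinuous functions *)

(** Convertible to the argument of the integrand in [iint], so slices that appear on unfolding are
    recognised. *)
Definition consr (R : realType) (n : nat) (t : R) (y : 'rV[R]_n) : 'rV[R]_n.+1 :=
  row_mx (const_mx t : 'rV_1) y.

Definition box (R : realType) (n : nat) (x : 'rV[R]_n) (d : R) : set 'rV[R]_n :=
  [set y | forall i, `|y ord0 i - x ord0 i| < d].

(* Iterated integrals of non-measurable slices are only monotone; additivity and
   scaling are recovered on lower semicontinuous integrands. *)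
Definition box_lsc (R : realType) (n : nat) (g : 'rV[R]_n -> \bar R) : Prop :=
  forall x a, (a%:E < g x)%E ->
    exists2 d, 0 < d & forall y, box x d y -> (a%:E < g y)%E.

Lemma consr0 (R : realType) (n : nat) (t : R) (y : 'rV[R]_n) :
  consr t y ord0 ord0 = t.
Proof.
rewrite /consr; have -> : ord0 = lshift n ord0 :> 'I_(1 + n) by apply: val_inj.
by rewrite (@row_mxEl _ 1 1 n) mxE.
Qed.

Lemma consrS (R : realType) (n : nat) (t : R) (y : 'rV[R]_n) i :
  consr t y ord0 (lift ord0 i) = y ord0 i.
Proof.
rewrite /consr; have -> : lift ord0 i = rshift 1 i :> 'I_(1 + n) by apply: val_inj.
by rewrite (@row_mxEr _ 1 1 n).
Qed.

Lemma consrK (R : realType) (n : nat) (x : 'rV[R]_n.+1) :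
  x = consr (x ord0 ord0) (\row_i x ord0 (lift ord0 i)).
Proof.
apply/rowP => i; case: (unliftP ord0 i) => [j|] ->.
  by rewrite consrS mxE.
by rewrite consr0.
Qed.

Lemma consr_lin (R : realType) (n : nat) (a b s t : R) (x y : 'rV[R]_n) :
  a *: consr s x + b *: consr t y = consr (a * s + b * t) (a *: x + b *: y).
Proof.
apply/rowP => i; case: (unliftP ord0 i) => [j|] ->.
  rewrite consrS; transitivity (a * consr s x ord0 (lift ord0 j) + b * consr t y ord0 (lift ord0 j)).
    by rewrite !mxE.
  by rewrite !consrS !mxE.
rewrite consr0; transitivity (a * consr s x ord0 ord0 + b * consr t y ord0 ord0).
  by rewrite !mxE.
by rewrite !consr0.
Qed.

Lemma box_consr (R : realType) (n : nat) (s t d : R) (x y : 'rV[R]_n) :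
  box (consr s x) d (consr t y) <-> `|t - s| < d /\ box x d y.
Proof.
split=> [h|[ts h] i].
  split=> [|i]; first by have := h ord0; rewrite !consr0.
  by have := h (lift ord0 i); rewrite !consrS.
by case: (unliftP ord0 i) => [j|] ->; rewrite ?consrS ?consr0.
Qed.

(** The integral of a nonnegative function is a supremum over the simple functions below it, so
    monotonicity asks for no measurability. *)
Lemma ge0_le_integralT (R : realType) (f g : R -> \bar R) :
  (forall t, 0 <= f t)%E -> (forall t, f t <= g t)%E ->
  (\int[@lebesgue_measure R]_t f t <= \int[@lebesgue_measure R]_t g t)%E.
Proof.
move=> f0 fg; have g0 t : (0 <= g t)%E by apply: le_trans (fg t).
rewrite !ge0_integralTE//; apply: ub_ereal_sup => _ [h /= hf <-].
by apply: ereal_sup_ubound; exists h => // t; exact: le_trans (fg t).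
Qed.

Lemma iint_ge0 (R : realType) (n : nat) (g : 'rV[R]_n -> \bar R) :
  (forall x, 0 <= g x)%E -> (0 <= iint g)%E.
Proof.
by elim: n g => [|n IH] g g0 //=; apply: integral_ge0 => t _; apply: IH.
Qed.

Lemma le_iint (R : realType) (n : nat) (g h : 'rV[R]_n -> \bar R) :
  (forall x, 0 <= g x)%E -> (forall x, g x <= h x)%E -> (iint g <= iint h)%E.
Proof.
elim: n g h => [|n IH] g h g0 gh /=; first exact: gh.
apply: ge0_le_integralT => t; first exact: iint_ge0.
by apply: IH.
Qed.

Lemma lee_real_lt (R : realType) (x y : \bar R) :
  (forall a : R, (a%:E < x -> a%:E <= y)%E) -> (x <= y)%E.
Proof.
move=> h; rewrite leNgt; apply/negP => yx.
case: x yx h => [x| |]; case: y => [y| |] //= yx h.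
- move: yx; rewrite lte_fin => yx.
  have := h ((x + y) / 2); rewrite lte_fin lee_fin.
  have H : (x + y) / 2 < x by lra.
  by move=> /(_ H); lra.
- by have := h (x - 1); rewrite lte_fin ltrBlDr ltrDl ltr01 => /(_ isT).
- have := h (y + 1); rewrite ltry => /(_ isT); rewrite lee_fin; lra.
- by have := h 0; rewrite ltry => /(_ isT).
Qed.

(** [F] lies below the liminf of the [Fk], and only the [Fk] enter Fatou's lemma. Phrasing
    convergence by strict real lower bounds gives hypothesis and conclusion the same shape, as the
    induction on the dimension requires. *)
Lemma integral_fatou_lt (R : realType) (F : R -> \bar R) (Fk : nat -> R -> \bar R) :
  (forall t, 0 <= F t)%E -> (forall k t, 0 <= Fk k t)%E ->
  (forall k, measurable_fun setT (Fk k)) ->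
  (forall t a, (a%:E < F t)%E -> exists N, forall k, (N <= k)%N -> (a%:E < Fk k t)%E) ->
  forall a, (a%:E < \int[@lebesgue_measure R]_t F t)%E ->
    exists N, forall k, (N <= k)%N -> (a%:E < \int[@lebesgue_measure R]_t Fk k t)%E.
Proof.
move=> F0 Fk0 mFk FFk a aF.
have einfE (u : (\bar R) ^nat) : limn_einf u = ereal_sup (range (einfs u)).
  by rewrite limn_einf_lim; apply/cvg_lim => //; exact: cvg_einfs_sup.
have FE t : (F t <= limn_einf (Fk^~ t))%E.
  apply: lee_real_lt => b bF; have [N hN] := FFk _ _ bF.
  rewrite einfE; apply: (@le_trans _ _ (einfs (Fk^~ t) N)).
    by apply: le_ereal_inf_tmp => _ [k /= Nk <-]; apply/ltW/hN.
  by apply: ereal_sup_ubound; exists N.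
have := le_trans (ge0_le_integralT F0 FE) (fatou lebesgue_measure measurableT mFk (fun k t _ => Fk0 k t)).
move=> /(lt_le_trans aF); rewrite einfE => /ereal_sup_gt[_ [N _ <-]] h.
exists N => k Nk; apply: (lt_le_trans h).
by apply: ereal_inf_lbound; exists k.
Qed.

(* The convergence hypothesis makes [g] a pointwise lower bound of the liminf of
   [gk]; no measurability of [g] is available. *)
Definition iint_fatou_at (R : realType) (n : nat) : Prop :=
  forall (g : 'rV[R]_n -> \bar R) (gk : nat -> 'rV[R]_n -> \bar R),
  (forall x, 0 <= g x)%E -> (forall k x, 0 <= gk k x)%E ->
  (forall k, box_lsc (gk k)) ->
  (forall x a, (a%:E < g x)%E -> exists N, forall k, (N <= k)%N -> (a%:E < gk k x)%E) ->
  forall a, (a%:E < iint g)%E ->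
    exists N, forall k, (N <= k)%N -> (a%:E < iint (gk k))%E.

Lemma box_lsc_consr (R : realType) (n : nat) (g : 'rV[R]_n.+1 -> \bar R) (t : R) :
  box_lsc g -> box_lsc (fun y => g (consr t y)).
Proof.
move=> lg x a /lg[d d0 hd]; exists d => // y xy; apply: hd.
by apply/box_consr; rewrite subrr normr0.
Qed.

(** Fatou's lemma in dimension [n], along a sequence of slices tending to [t], makes the slice
    integral lower semicontinuous in [t]. Taking it as a hypothesis lets the proof in dimension
    [n.+1] call this lemma. *)
Lemma iint_fatou_at_measurable (R : realType) (n : nat) (g : 'rV[R]_n.+1 -> \bar R) :
  iint_fatou_at R n -> (forall x, 0 <= g x)%E -> box_lsc g ->
  measurable_fun setT (fun t => iint (fun y => g (consr t y))).
Proof.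
move=> fat g0 lg; apply: lower_semicontinuous_measurable => t a at_.
apply: contrapT => H.
have : forall k : nat, exists s : R, `|t - s| < k.+1%:R^-1 /\
    ~ (a%:E < iint (fun y => g (consr s y)))%E.
  move=> k; apply: contrapT => H1; apply: H.
  exists (ball t k.+1%:R^-1); first by apply: nbhsx_ballx; rewrite invr_gt0.
  by move=> s ts; apply: contrapT => H2; apply: H1; exists s.
move=> /choice[s sP].
have [|N /(_ _ (leqnn _))] := fat _ (fun k y => g (consr (s k) y)) (fun y => g0 (consr t y))
  (fun k y => g0 (consr (s k) y)) (fun k => @box_lsc_consr _ _ _ (s k) lg) _ a at_.
  move=> y b /lg[d d0 hd].
  have [N hN] : exists N : nat, N.+1%:R^-1 < d.
    exists (Num.bound d^-1).
    rewrite -[ltRHS]invrK ltf_pV2 ?posrE ?invr_gt0//.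
    apply: (@lt_trans _ _ (Num.bound d^-1)%:R); last by rewrite ltr_nat.
    by apply: archi_boundP; rewrite invr_ge0 ltW.
  exists N => k Nk; apply: hd; apply/box_consr; split=> [|i]; last by rewrite subrr normr0.
  rewrite distrC; apply: lt_trans (proj1 (sP k)) (le_lt_trans _ hN).
  by rewrite lef_pV2 ?posrE// ler_nat.
by have [_] := sP N.
Qed.

Lemma iint_fatou (R : realType) (n : nat) : iint_fatou_at R n.
Proof.
elim: n => [|n IH] g gk g0 gk0 lgk ggk a /=; first exact: ggk.
apply: integral_fatou_lt.
- by move=> t; exact: iint_ge0.
- by move=> k t; exact: iint_ge0.
- by move=> k; exact: iint_fatou_at_measurable.
- move=> t b; apply: IH => //; first by move=> k; exact: box_lsc_consr.
  by move=> x c; exact: ggk.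
Qed.

Lemma measurable_iint_slice (R : realType) (n : nat) (g : 'rV[R]_n.+1 -> \bar R) :
  (forall x, 0 <= g x)%E -> box_lsc g ->
  measurable_fun setT (fun t => iint (fun y => g (consr t y))).
Proof. by apply: iint_fatou_at_measurable; exact: iint_fatou. Qed.

Lemma iintD (R : realType) (n : nat) (g h : 'rV[R]_n -> \bar R) :
  (forall x, 0 <= g x)%E -> (forall x, 0 <= h x)%E -> box_lsc g -> box_lsc h ->
  iint (fun x => g x + h x)%E = (iint g + iint h)%E.
Proof.
elim: n g h => [//|n IH] g h g0 h0 lg lh /=.
rewrite -ge0_integralD//; last 4 first.
- by move=> t _; exact: iint_ge0.
- exact: measurable_iint_slice.
- by move=> t _; exact: iint_ge0.
- exact: measurable_iint_slice.
by apply: eq_integral => t _; apply: IH => //; exact: box_lsc_consr.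
Qed.

Lemma iintZ (R : realType) (n : nat) (g : 'rV[R]_n -> \bar R) (c : R) :
  0 <= c -> (forall x, 0 <= g x)%E -> box_lsc g ->
  iint (fun x => c%:E * g x)%E = (c%:E * iint g)%E.
Proof.
move=> c0; elim: n g => [//|n IH] g g0 lg /=.
rewrite -ge0_integralZl//; last 2 first.
- exact: measurable_iint_slice.
- by move=> t _; exact: iint_ge0.
by apply: eq_integral => t _; apply: IH => //; exact: box_lsc_consr.
Qed.

(** Lebesgue measure equals [l] times its image under the affine map, by uniqueness on half-open
    intervals. *)
Lemma ge0_integral_affine (R : realType) (l c : R) (F : R -> \bar R) :
  0 < l -> (forall t, 0 <= F t)%E -> measurable_fun setT F ->
  (\int[@lebesgue_measure R]_t F (l * t + c)%R = (l^-1)%:E * \int[@lebesgue_measure R]_t F t)%E.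
Proof.
move=> l0 F0 mF.
pose phi (t : R) : R := l * t + c.
have mphi : measurable_fun setT phi.
  by apply: measurable_funD => //; exact: mulrl_measurable.
have il0 : 0 <= l by exact: ltW.
have [m [mP mI]] : exists m : {measure set (measurableTypeR R) -> \bar R},
    (forall A, m A = pushforward (@lebesgue_measure R) phi A) /\
    (\int[m]_t F t = \int[@lebesgue_measure R]_t F (phi t))%E.
  unshelve refine (ex_intro _ (pushforward (@lebesgue_measure R) (phi : measurableTypeR R -> measurableTypeR R) : {measure set (measurableTypeR R) -> \bar R}) _) => //.
  by split => //; rewrite (@ge0_integral_pushforward _ _ (measurableTypeR R) (measurableTypeR R)).
have mE A : measurable A -> lebesgue_measure A = mscale (NngNum il0) m A.
  apply: lebesgue_measure_unique => _ [[a b] _ <-].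
  transitivity (l%:E * pushforward (@lebesgue_measure R) phi `]a, b]%classic)%E; last by rewrite -mP.
  rewrite /pushforward/=.
  have -> : phi @^-1` `]a, b] = [set` `](a - c) / l, (b - c) / l] ].
    apply/seteqP; split=> t /=; rewrite !in_itv/= /phi.
      by move=> /andP[h1 h2]; rewrite ltr_pdivrMr// ler_pdivlMr//; apply/andP; split; lra.
    by rewrite ltr_pdivrMr// ler_pdivlMr// => /andP[h1 h2]; apply/andP; split; lra.
  rewrite !lebesgue_measure_itv/= !lte_fin ltr_pM2r ?invr_gt0// ltrD2r.
  case: ifPn => _; last by rewrite mule0.
  by rewrite -EFinD -EFinM; congr EFin; field; rewrite gt_eqF.
have -> : (\int[@lebesgue_measure R]_t F t = \int[mscale (NngNum il0) m]_t F t)%E.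
  by apply: eq_measure_integral => A mA _; exact: mE.
rewrite ge0_integral_mscale//.
rewrite mI.
by rewrite muleA -EFinM/= mulVf ?gt_eqF// mul1e.
Qed.

Lemma iint_affine (R : realType) (n : nat) (g : 'rV[R]_n -> \bar R) (l : R) (v : 'rV[R]_n) :
  0 < l -> (forall x, 0 <= g x)%E -> box_lsc g ->
  iint (fun x => g (l *: x + v)) = ((l ^- n)%:E * iint g)%E.
Proof.
move=> l0; elim: n g v => [|n IH] g v g0 lg /=.
  by rewrite expr0 invr1 mul1e; congr g; apply/rowP => -[].
rewrite -/(iint (n := n.+1) _).
transitivity (\int[@lebesgue_measure R]_t
   ((l ^- n)%:E * iint (fun y => g (consr (l * t + v ord0 ord0) y))))%E.
  apply: eq_integral => t _.
  rewrite -(IH _ (\row_i v ord0 (lift ord0 i)))//; last exact: box_lsc_consr.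
  congr iint; apply/funext => y; congr g.
  by rewrite {1}(consrK v) -[X in _ + X]scale1r consr_lin !scale1r mul1r.
have mg := measurable_iint_slice g0 lg.
rewrite ge0_integralZl//; last 3 first.
- apply: (measurableT_comp mg); apply: measurable_funD => //; exact: mulrl_measurable.
- by move=> t _; exact: iint_ge0.
- by rewrite lee_fin invr_ge0 exprn_ge0// ltW.
rewrite (@ge0_integral_affine _ _ _ (fun t => iint (fun y => g (consr t y))))//; last first.
  by move=> t; exact: iint_ge0.
by rewrite muleA -EFinM exprSr invfM mulrC.
Qed.

Lemma iint_box (R : realType) (n : nat) (g : 'rV[R]_n -> \bar R) (x : 'rV[R]_n) (c d : R) :
  0 <= c -> 0 < d -> (forall y, 0 <= g y)%E ->
  (forall y, box x d y -> c%:E <= g y)%E ->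
  ((c * (2 * d) ^+ n)%:E <= iint g)%E.
Proof.
move=> c0 d0; elim: n g x => [|n IH] g x g0 hg /=.
  by rewrite expr0 mulr1; apply: hg => -[].
have E0 : 0 <= c * (2 * d) ^+ n by rewrite mulr_ge0// exprn_ge0// mulr_ge0// ltW.
pose I : set R := [set` `]x ord0 ord0 - d, x ord0 ord0 + d[ ].
apply: (@le_trans _ _ (\int[@lebesgue_measure R]_t
   ((c * (2 * d) ^+ n)%:E * (\1_I t)%:E))%E).
  rewrite ge0_integralZl ?lee_fin//; last by apply/measurable_EFinP; apply: measurable_indic; exact: measurable_itv.
  rewrite integral_indic ?setIT//=; last exact: measurable_itv.
  rewrite /I lebesgue_measure_itv/= lte_fin.
  have -> : x ord0 ord0 - d < x ord0 ord0 + d by lra.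
  by rewrite -EFinD -EFinM lee_fin exprSr mulrA; apply: ler_wpM2l => //; lra.
apply: ge0_le_integralT => t; first by rewrite -EFinM lee_fin mulr_ge0// indicE.
rewrite indicE; case: (boolP (t \in I)) => [|_]; last by rewrite mule0 iint_ge0.
rewrite inE /I/= in_itv/= mule1 => /andP[h1 h2].
apply: (IH _ (\row_i x ord0 (lift ord0 i))) => // y xy.
apply: hg; rewrite (consrK x); apply/box_consr; split => //.
by rewrite ltr_norml; apply/andP; split; lra.
Qed.

(** * Log-concave functions and their lower semicontinuous hulls *)

Lemma log_concave_ge_min (R : realType) (n : nat) (f : 'rV[R]_n -> R) x y (m s : R) :
  log_concave f -> 0 <= m -> 0 <= s <= 1 -> m <= f x -> m <= f y ->
  m <= f ((1 - s) *: x + s *: y).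
Proof.
move=> [_ lf] m0 s01 mx my; apply: le_trans (lf _ _ _ s01).
move: s01 => /andP[s0 s1].
have -> : m = m `^ (1 - s) * m `^ s.
  by rewrite -powRD ?subrK ?powRr1// oner_eq0.
by apply: ler_pM; rewrite ?powR_ge0// ge0_ler_powR ?nnegrE ?subr_ge0// (le_trans m0).
Qed.

Lemma log_concave_consr (R : realType) (n : nat) (f : 'rV[R]_n.+1 -> R) t :
  log_concave f -> log_concave (fun y => f (consr t y)).
Proof.
move=> [f0 lf]; split=> // x y s s01; have := lf (consr t x) (consr t y) s s01.
by rewrite consr_lin -mulrDl subrK mul1r.
Qed.

(** By induction on the dimension, two parallel slices each contain a box where [f] is bounded
    below; by convexity of superlevel sets, so does a box halfway between them. *)
Lemma iint_gt0_box (R : realType) (n : nat) (f : 'rV[R]_n -> R) :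
  log_concave f -> (0 < iint (fun x => (f x)%:E))%E ->
  exists p d m, [/\ 0 < d, 0 < m & forall y, box p d y -> m <= f y].
Proof.
elim: n f => [|n IH] f lf.
  rewrite /= lte_fin => f0; exists 0, 1, (f 0); split => // y _.
  by rewrite (_ : y = 0)//; apply/rowP => -[].
move=> If.
pose F t := iint (fun y => (f (consr t y))%:E).
have F0 t : (0 <= F t)%E by apply: iint_ge0 => y; rewrite lee_fin; case: lf.
(* Slice integrals that are positive for at most one [t] would integrate to 0. *)
have [t1 [t2 [t12 [F1 F2]]]] : exists t1 t2, t1 < t2 /\ ((0 < F t1)%E /\ (0 < F t2)%E).
  apply: contrapT => H; move: If; change (~ (0 < \int[@lebesgue_measure R]_t F t)%E).
  have [[t0 F00]|no] := pselect (exists t, (0 < F t)%E).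
    have -> : F = F \_ [set t0].
      apply/funext => t; rewrite patchE; case: ifPn => //.
      rewrite notin_setE/= => tt0; apply/eqP; rewrite eq_le F0 andbT leNgt.
      apply/negP => Ft; apply: H.
      by have [|t0t|//] := ltgtP t t0; [exists t, t0|exists t0, t].
    by rewrite -integral_mkcond integral_set1 ltxx.
  have -> : F = cst 0%E.
    apply/funext => t; apply/eqP; rewrite eq_le F0 andbT leNgt.
    by apply/negP => Ft; apply: no; exists t.
  by rewrite integral0 ltxx.
have [p1 [d1 [m1 [d10 m10 h1]]]] := IH _ (log_concave_consr t1 lf) F1.
have [p2 [d2 [m2 [d20 m20 h2]]]] := IH _ (log_concave_consr t2 lf) F2.
pose d := Num.min d1 d2; pose m := Num.min m1 m2.
have d0 : 0 < d by rewrite lt_min d10.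
have m0 : 0 < m by rewrite lt_min m10.
pose D := \sum_i `|p1 ord0 i - p2 ord0 i|.
have D0 : 0 <= D by apply: sumr_ge0.
have Di i : `|p1 ord0 i - p2 ord0 i| <= D.
  by rewrite /D (bigD1 i)//= lerDl sumr_ge0.
have l0 : 0 < t2 - t1 by rewrite subr_gt0.
(* Moving the first coordinate by [e] shifts the interpolated centre by at most [e * D / (t2 - t1)];
   together with the offset [e] in the other coordinates this is [e * K]. *)
pose K := 1 + D / (t2 - t1).
have K0 : 0 < K by rewrite ltr_wpDr// divr_ge0// ltW.
pose e := Num.min ((t2 - t1) / 4) (d / K).
have e0 : 0 < e by rewrite lt_min !divr_gt0.
exists (consr ((t1 + t2) / 2) (2^-1 *: (p1 + p2))), e, m; split => // z.
rewrite (consrK z); set t := z ord0 ord0; set y := \row_i _.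
move=> /box_consr[ht hy].
pose s := (t - t1) / (t2 - t1).
have hs : `|s - 2^-1| < e / (t2 - t1).
  rewrite ltr_pdivlMr// -[X in _ * X]ger0_norm ?(ltW l0)// -normrM.
  by rewrite (_ : _ * _ = t - (t1 + t2) / 2)// /s; field; rewrite gt_eqF.
have hs4 : e / (t2 - t1) <= 4^-1.
  by rewrite ler_pdivrMr// mulrC ge_min lexx.
have s01 : 0 <= s <= 1.
  have := lt_le_trans hs hs4; rewrite ltr_norml => /andP[h3 h4].
  by apply/andP; split; lra.
(* The same offset [r] is added to both centres, so that [y] interpolates [p1 + r] and [p2 + r]. *)
pose r := y - ((1 - s) *: p1 + s *: p2).
have hr i : `|r ord0 i| < d.
  have -> : r ord0 i = (y ord0 i - (2^-1 *: (p1 + p2)) ord0 i) +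
      (s - 2^-1) * (p1 ord0 i - p2 ord0 i).
    by rewrite !mxE; field.
  apply: le_lt_trans (ler_normD _ _) _.
  apply: (@lt_le_trans _ _ (e + e / (t2 - t1) * D)).
    apply: ltr_leD; first exact: hy.
    by rewrite normrM; apply: ler_pM => //; exact: ltW.
  have -> : e + e / (t2 - t1) * D = e * K by rewrite /K; field; rewrite gt_eqF.
  by rewrite -ler_pdivlMr// ge_min lexx orbT.
have -> : consr t y = (1 - s) *: consr t1 (p1 + r) + s *: consr t2 (p2 + r).
  rewrite consr_lin; congr consr; first by rewrite /s; field; rewrite gt_eqF.
  by apply/rowP => i; rewrite !mxE; ring.
apply: (log_concave_ge_min lf (ltW m0) s01).
  apply: le_trans (h1 _ _); first by rewrite ge_min lexx.
  by move=> i; rewrite mxE addrAC subrr add0r (lt_le_trans (hr i))// ge_min lexx.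
apply: le_trans (h2 _ _); first by rewrite ge_min lexx orbT.
by move=> i; rewrite mxE addrAC subrr add0r (lt_le_trans (hr i))// ge_min lexx orbT.
Qed.

(** On the box of half size around the midpoint of [x] and [p], [f] is at least the square root of
    [f x * m]; integrating over that box bounds [f x]. *)
Lemma log_concave_bounded (R : realType) (n : nat) (f : 'rV[R]_n -> R) p (d m : R) :
  log_concave f -> (iint (fun x => (f x)%:E) < +oo)%E ->
  0 < d -> 0 < m -> (forall y, box p d y -> m <= f y) ->
  exists K, forall x, f x <= K.
Proof.
move=> [f0 lf] If d0 m0 hm.
have I0 : (0 <= iint (fun x => (f x)%:E))%E by apply: iint_ge0 => x; rewrite lee_fin.
have Ifin : (iint (fun x => (f x)%:E)) \is a fin_num by rewrite ge0_fin_numE.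
pose I := fine (iint (fun x => (f x)%:E)).
exists ((I / d ^+ n) ^+ 2 / m) => x.
rewrite ler_pdivlMr// -[leLHS]sqr_sqrtr ?mulr_ge0 ?(ltW m0)//.
rewrite lerXn2r ?nnegrE ?sqrtr_ge0 ?divr_ge0 ?exprn_ge0 ?fine_ge0 ?(ltW d0)//.
rewrite ler_pdivlMr ?exprn_gt0// -lee_fin /I fineK//.
have -> : d = 2 * (d / 2) by field.
apply: (@iint_box _ _ _ (2^-1 *: (x + p))); rewrite ?sqrtr_ge0 ?divr_gt0//.
move=> y hy; rewrite lee_fin.
have -> : y = (1 - 2^-1) *: x + 2^-1 *: (2 *: y - x).
  by apply/rowP => i; rewrite !mxE; field.
have h01 : 0 <= (2^-1 : R) <= 1 by apply/andP; split; lra.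
apply: le_trans (lf _ _ _ h01).
have -> : 1 - 2^-1 = 2^-1 :> R by field.
rewrite -powRM// powR12_sqrt ?mulr_ge0//.
apply: ler_wsqrtr; rewrite ler_wpM2l// hm// => i.
have := hy i; rewrite !mxE => hyi.
have -> : 2 * y ord0 i - x ord0 i - p ord0 i =
   2 * (y ord0 i - 2^-1 * (x ord0 i + p ord0 i)) by field.
by rewrite normrM ger0_norm//; lra.
Qed.

(** The lower semicontinuous envelope of a nonnegative function, taken with boxes as
    neighbourhoods. *)
Definition lsc_hull (R : realType) (n : nat) (f : 'rV[R]_n -> R) (x : 'rV[R]_n) : R :=
  sup [set c | 0 <= c /\ exists2 d, 0 < d & forall y, box x d y -> c <= f y].

Lemma box_center (R : realType) (n : nat) (x : 'rV[R]_n) d : 0 < d -> box x d x.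
Proof. by move=> d0 i; rewrite subrr normr0. Qed.

Section lsc_hull.
Context (R : realType) (n : nat) (f : 'rV[R]_n -> R).
Hypothesis f0 : forall x, 0 <= f x.

Let hull_has_sup x :
  has_sup [set c | 0 <= c /\ exists2 d, 0 < d & forall y, box x d y -> c <= f y].
Proof.
split; first by exists 0; split => //; exists 1.
by exists (f x) => c [_ [d d0 h]]; apply: h; exact: box_center.
Qed.

Lemma lsc_hull_le x : lsc_hull f x <= f x.
Proof.
apply: ge_sup; first by case: (hull_has_sup x).
by move=> c [_ [d d0 h]]; apply: h; exact: box_center.
Qed.

Lemma lsc_hull_ge x d c : 0 <= c -> 0 < d ->
  (forall y, box x d y -> c <= f y) -> c <= lsc_hull f x.
Proof.
move=> c0 d0 h; apply: ub_le_sup; first by case: (hull_has_sup x).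
by split => //; exists d.
Qed.

Lemma lsc_hull_ge0 x : 0 <= lsc_hull f x.
Proof. exact: (@lsc_hull_ge x 1). Qed.

Lemma lsc_hull_lsc : box_lsc (EFin \o lsc_hull f).
Proof.
move=> x a /=; rewrite lte_fin => /sup_gt[|c [c0 [d d0 h]] ac].
  by case: (hull_has_sup x).
exists (d / 2) => [|y xy]; first by rewrite divr_gt0.
rewrite lte_fin (lt_le_trans ac)//.
have d20 : 0 < d / 2 by rewrite divr_gt0.
apply: (lsc_hull_ge c0 d20) => z yz; apply: h => i.
have -> : z ord0 i - x ord0 i = (z ord0 i - y ord0 i) + (y ord0 i - x ord0 i) by ring.
apply: le_lt_trans (ler_normD _ _) _; have := xy i; have := yz i; lra.
Qed.

End lsc_hull.

(** Each [y] near the contracted point is [(1 - s) *: x + s *: p'] with [p'] in the box around [p],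
    so a value of [f] at one point controls a neighbourhood. *)
Lemma log_concave_contract (R : realType) (n : nat) (f : 'rV[R]_n -> R) p (d m s : R) x y :
  log_concave f -> 0 < m -> (forall y, box p d y -> m <= f y) ->
  0 < s < 1 -> box ((1 - s) *: x + s *: p) (s * d) y ->
  f x `^ (1 - s) * m `^ s <= f y.
Proof.
move=> [f0 lf] m0 hm /andP[s0 s1] hy.
have -> : y = (1 - s) *: x + s *: (s^-1 *: (y - (1 - s) *: x)).
  by rewrite scalerA mulfV ?gt_eqF// scale1r addrC subrK.
have s01 : 0 <= s <= 1 by rewrite !ltW.
apply: le_trans (lf _ _ _ s01); rewrite ler_wpM2l ?powR_ge0//.
rewrite ge0_ler_powR ?nnegrE ?(ltW s0) ?(ltW m0)// hm// => i.
have := hy i; rewrite !mxE => hyi.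
have -> : s^-1 * (y ord0 i - (1 - s) * x ord0 i) - p ord0 i =
   s^-1 * (y ord0 i - ((1 - s) * x ord0 i + s * p ord0 i)) by field; rewrite gt_eqF.
by rewrite normrM ger0_norm ?invr_ge0 ?(ltW s0)// ltr_pdivrMl.
Qed.

Lemma lsc_hull_contract (R : realType) (n : nat) (f : 'rV[R]_n -> R) p (d m s : R) x :
  log_concave f -> 0 < d -> 0 < m -> (forall y, box p d y -> m <= f y) ->
  0 < s < 1 -> f x `^ (1 - s) * m `^ s <= lsc_hull f ((1 - s) *: x + s *: p).
Proof.
move=> lf d0 m0 hm s01; have [f0 _] := lf.
apply: (lsc_hull_ge f0 (d := s * d)).
- by rewrite mulr_ge0// powR_ge0.
- by rewrite mulr_gt0//; case/andP: s01.
by move=> y; exact: log_concave_contract.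
Qed.

Lemma box_lscM (R : realType) (n : nat) (g h : 'rV[R]_n -> R) :
  (forall x, 0 <= g x) -> (forall x, 0 <= h x) ->
  box_lsc (EFin \o g) -> box_lsc (EFin \o h) -> box_lsc (fun x => (g x * h x)%:E).
Proof.
move=> g0 h0 lg lh x a; rewrite lte_fin => axy.
have [a0|a0] := ltP a 0.
  by exists 1 => // y _; rewrite lte_fin (lt_le_trans a0)// mulr_ge0.
have gh : 0 < g x * h x by apply: le_lt_trans axy.
have gx : 0 < g x by rewrite lt_neqAle g0 andbT; apply/eqP => E; rewrite -E mul0r ltxx in gh.
have hx : 0 < h x by rewrite lt_neqAle h0 andbT; apply/eqP => E; rewrite -E mulr0 ltxx in gh.
(* Any [b] strictly between [a / h x] and [g x] splits the threshold [a] into [b] for [g] and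
   [a / b] for [h]. *)
pose b := (a / h x + g x) / 2.
have b1 : a / h x < g x by rewrite ltr_pdivrMr.
have ah0 : 0 <= a / h x by rewrite divr_ge0// ltW.
have bg : b < g x by rewrite /b; lra.
have b0 : 0 < b by rewrite /b; lra.
have ch : a / b < h x.
  by rewrite ltr_pdivrMr// mulrC -ltr_pdivrMr// /b; lra.
have [d1 d10 h1] := lg x b (ltac:(by rewrite lte_fin)).
have [d2 d20 h2] := lh x (a / b) (ltac:(by rewrite lte_fin)).
exists (Num.min d1 d2) => [|y hy]; first by rewrite lt_min d10.
have hy1 : (b%:E < (g y)%:E)%E.
  by apply: h1 => i; rewrite (lt_le_trans (hy i))// ge_min lexx.
have hy2 : ((a / b)%:E < (h y)%:E)%E.
  by apply: h2 => i; rewrite (lt_le_trans (hy i))// ge_min lexx orbT.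
rewrite !lte_fin in hy1 hy2 *.
have -> : a = b * (a / b) by rewrite mulrC divfK// gt_eqF.
by apply: ltr_pM => //; [exact: ltW|rewrite divr_ge0// ltW].
Qed.

Lemma box_lscD (R : realType) (n : nat) (g h : 'rV[R]_n -> R) :
  box_lsc (EFin \o g) -> box_lsc (EFin \o h) -> box_lsc (fun x => (g x + h x)%:E).
Proof.
move=> lg lh x a; rewrite lte_fin => axy.
pose e := (g x + h x - a) / 2; have e0 : 0 < e by rewrite /e; lra.
have [d1 d10 h1] := lg x (g x - e) (ltac:(by rewrite lte_fin ltrBlDr ltrDl)).
have [d2 d20 h2] := lh x (h x - e) (ltac:(by rewrite lte_fin ltrBlDr ltrDl)).
exists (Num.min d1 d2) => [|y hy]; first by rewrite lt_min d10.
have hy1 : ((g x - e)%:E < (g y)%:E)%E.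
  by apply: h1 => i; rewrite (lt_le_trans (hy i))// ge_min lexx.
have hy2 : ((h x - e)%:E < (h y)%:E)%E.
  by apply: h2 => i; rewrite (lt_le_trans (hy i))// ge_min lexx orbT.
by move: hy1 hy2; rewrite !lte_fin /e; lra.
Qed.

Lemma box_lsc_cst (R : realType) (n : nat) (c : R) :
  @box_lsc R n (EFin \o cst c).
Proof. by move=> x a ac; exists 1. Qed.

Lemma box_lsc_maxr (R : realType) (n : nat) (i : 'I_n) :
  @box_lsc R n (fun x => (Num.max (x ord0 i) 0)%:E).
Proof.
move=> x a; rewrite lte_fin => ha.
exists (Num.max (x ord0 i) 0 - a) => [|y /(_ i)]; first by rewrite subr_gt0.
rewrite lte_fin ltr_norml => /andP[h1 _]; move: ha h1; rewrite !maxEle.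
by case: ifP; case: ifP; lra.
Qed.

Lemma box_lsc_maxrN (R : realType) (n : nat) (i : 'I_n) :
  @box_lsc R n (fun x => (Num.max (- x ord0 i) 0)%:E).
Proof.
move=> x a; rewrite lte_fin => ha.
exists (Num.max (- x ord0 i) 0 - a) => [|y /(_ i)]; first by rewrite subr_gt0.
rewrite lte_fin ltr_norml => /andP[_ h1]; move: ha h1; rewrite !maxEle.
by case: ifP; case: ifP; lra.
Qed.

Lemma lim_at0_ge (R : realType) (A c b D : R) :
  (forall s, 0 < s < 2^-1 -> A <= expR (c * s) * (b + s * D)) -> A <= b.
Proof.
move=> h; pose F (s : R) := expR (c * s) * (b + s * D).
have cF : continuous F.
  move=> s; apply: cvgM.
    apply: continuous_comp; last exact: continuous_expR.
    by apply: cvgM; [exact: cvg_cst|exact: cvg_id].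
  by apply: cvgD; [exact: cvg_cst|apply: cvgM; [exact: cvg_id|exact: cvg_cst]].
have F0 : F 0 = b by rewrite /F mulr0 expR0 mul0r addr0 mul1r.
have cr : F s @[s --> 0^'+] --> b by rewrite -F0; apply: cvg_at_right_filter; exact: cF.
apply: (cvgr_to_ge cr); near=> s; apply: h; apply/andP; split.
  by near: s; exact: nbhs_right_gt.
by near: s; apply: nbhs_right_lt; rewrite invr_gt0.
Unshelve. all: by end_near. Qed.

Lemma expR_inv_le (R : realType) (s : R) : 0 < s < 2^-1 -> (1 - s)^-1 <= expR (2 * s).
Proof.
move=> /andP[s0 s1]; have h := expR_ge1Dx (2 * s).
rewrite -[leLHS]mulr1 ler_pdivrMl; last lra.
have : (1 - s) * (1 + 2 * s) <= (1 - s) * expR (2 * s) by rewrite ler_wpM2l//; lra.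
have : 0 <= s * (1 - 2 * s) by rewrite mulr_ge0//; lra.
lra.
Qed.

(* [f x ^ (1 - s) m ^ s] is at most the hull at [(1 - s) x + s p], so [int w f] is
   at most [int w g] up to factors tending to 1 as [s] tends to 0. *)
Lemma iint_lsc_hull (R : realType) (n : nat) (f w : 'rV[R]_n -> R) p (d m c : R) :
  log_concave f -> (iint (fun x => (f x)%:E) < +oo)%E ->
  0 < d -> 0 < m -> (forall y, box p d y -> m <= f y) ->
  (forall x, 0 <= w x) -> box_lsc (EFin \o w) -> 0 <= c ->
  (forall x s, 0 < s < 1 ->
    w x <= (1 - s)^-1 * (w ((1 - s) *: x + s *: p) + s * c)) ->
  iint (fun x => (w x * f x)%:E) = iint (fun x => (w x * lsc_hull f x)%:E).
Proof.
move=> lcf If d0 m0 hm w0 lw c0 hw; have [f0 lf] := lcf.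
have [K0 hK0] := log_concave_bounded lcf If d0 m0 hm.
pose g := lsc_hull f; have g0 := lsc_hull_ge0 f0; have lg := lsc_hull_lsc f0.
have gf := lsc_hull_le f0.
have wg0 x : (0 <= (w x * g x)%:E)%E by rewrite lee_fin mulr_ge0.
have lwg := box_lscM w0 g0 lw lg.
apply/eqP; rewrite eq_le; apply/andP; split; last first.
  by apply: le_iint => // x; rewrite lee_fin ler_wpM2l.
have Ig0 : (0 <= iint (fun x => (w x * g x)%:E))%E by exact: iint_ge0.
have [->|bfin] := eqVneq (iint (fun x => (w x * g x)%:E)) +oo%E; first by rewrite leey.
have bE : (iint (fun x => (w x * g x)%:E)) \is a fin_num.
  by rewrite ge0_fin_numE// lt_neqAle bfin leey.
have aE : (iint (fun x => (g x)%:E)) \is a fin_num.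
  rewrite ge0_fin_numE; last by apply: iint_ge0 => x; rewrite lee_fin.
  by apply: le_lt_trans If; apply: le_iint => x; rewrite lee_fin.
pose K := Num.max K0 m; have hK x : f x <= K by rewrite le_max hK0.
have mK : m <= K by rewrite le_max lexx orbT.
have K_gt0 : 0 < K by exact: lt_le_trans mK.
set b := iint (fun x => (w x * g x)%:E) in bfin bE *.
set a := iint (fun x => (g x)%:E) in aE.
(* In the exponent, [ln (K / m)] comes from trading [f x ^ s] for [m ^ s], and [2 * n.+1%:R] from
   one factor [(1 - s)^-1] of the weight and [n] of the Jacobian, by [expR_inv_le]. *)
have key s : 0 < s < 2^-1 ->
  (iint (fun x => (w x * f x)%:E) <=
   (expR ((ln (K / m) + 2 * n.+1%:R) * s) * (fine b + s * (c * fine a)))%:E)%E.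
  move=> s12; have [s0 s2] : 0 < s /\ s < 2^-1 by apply/andP.
  have s1 : s < 1 by lra.
  have s01 : 0 < s < 1 by rewrite s0.
  have l0 : 0 < 1 - s by lra.
  pose kap := (K / m) `^ s * (1 - s)^-1.
  have kap0 : 0 <= kap by rewrite mulr_ge0 ?powR_ge0// invr_ge0 ltW.
  pose h x : R := w x * g x + s * c * g x.
  have h0 x : 0 <= h x by rewrite addr_ge0 ?mulr_ge0// ltW.
  have lsg : box_lsc (fun x => (s * c * g x)%:E).
    apply: (@box_lscM _ _ (cst (s * c)) g) => //; last exact: box_lsc_cst.
    by move=> x; rewrite mulr_ge0// ltW.
  have lh : box_lsc (EFin \o h) := box_lscD lwg lsg.
  have pw x : w x * f x <= kap * h ((1 - s) *: x + s *: p).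
    have gx := lsc_hull_contract x lcf d0 m0 hm s01; rewrite -/g in gx.
    have fx : f x <= (K / m) `^ s * g ((1 - s) *: x + s *: p).
      apply: (@le_trans _ _ ((K / m) `^ s * (f x `^ (1 - s) * m `^ s))); last first.
        by rewrite ler_wpM2l// powR_ge0.
      rewrite mulrCA -powRM ?divr_ge0 ?(ltW m0) ?(ltW K_gt0)// divfK ?gt_eqF//.
      have {1}-> : f x = f x `^ (1 - s) * f x `^ s.
        by rewrite -powRD ?subrK ?powRr1// oner_eq0.
      by rewrite ler_wpM2l ?powR_ge0// ge0_ler_powR ?nnegrE ?(ltW s0)// ltW.
    apply: le_trans (ler_pM (w0 x) (f0 x) (hw x s s01) fx) _.
    by rewrite /kap /h le_eqVlt; apply/orP; left; apply/eqP; ring.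
  apply: (@le_trans _ _ (iint (fun x => kap%:E * (h ((1 - s) *: x + s *: p))%:E)%E)).
    apply: le_iint => x; first by rewrite lee_fin mulr_ge0.
    by rewrite -EFinM lee_fin.
  have laff : box_lsc (fun x => (h ((1 - s) *: x + s *: p))%:E).
    move=> x t /lh[e e0 he]; exists e => // y hy; apply: he => i.
    have := hy i; rewrite !mxE => hyi.
    rewrite opprD addrACA subrr addr0 -mulrBr normrM ger0_norm ?(ltW l0)//.
    by apply: le_lt_trans hyi; rewrite ler_piMl//; lra.
  rewrite (@iintZ _ _ (fun x => (h ((1 - s) *: x + s *: p))%:E))//; last by move=> x; rewrite lee_fin.
  rewrite (@iint_affine _ _ (EFin \o h))//.
  have -> : iint (EFin \o h) = (b + (s * c)%:E * a)%E.
    rewrite -(@iintZ _ _ (fun x => (g x)%:E))//; last by rewrite mulr_ge0// ltW.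
    rewrite -iintD// => x; rewrite -?EFinM lee_fin//.
    by rewrite ?mulr_ge0// ltW.
  have -> : (kap%:E * (((1 - s) ^- n)%:E * (b + (s * c)%:E * a)) =
      (kap * (1 - s) ^- n * (fine b + s * (c * fine a)))%:E)%E.
    have [B bB] : exists B, b = B%:E by exists (fine b); rewrite fineK.
    have [A aA] : exists A, a = A%:E by exists (fine a); rewrite fineK.
    by rewrite bB aA /=; congr EFin; ring.
  rewrite lee_fin.
  have b0 : 0 <= fine b by rewrite fine_ge0.
  have a0 : 0 <= fine a by rewrite fine_ge0//; apply: iint_ge0 => x; rewrite lee_fin.
  apply: ler_wpM2r; first by rewrite addr_ge0// ?mulr_ge0// ltW.
  have Km : 0 < K / m by rewrite divr_gt0.
  rewrite mulrDl expRD /kap /powR gt_eqF// [s * ln _]mulrC -mulrA.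
  apply: ler_wpM2l; first exact: expR_ge0.
  rewrite -exprVn -exprS.
  have -> : 2 * n.+1%:R * s = n.+1%:R * (2 * s) by ring.
  rewrite expRM_natl lerXn2r ?nnegrE ?invr_ge0 ?expR_ge0 ?(ltW l0)//.
  exact: expR_inv_le.
have If0 : (0 <= iint (fun x => (w x * f x)%:E))%E.
  by apply: iint_ge0 => x; rewrite lee_fin mulr_ge0.
(* A single value of [s] already gives finiteness, after which the limit is taken in the reals. *)
have AE : (iint (fun x => (w x * f x)%:E)) \is a fin_num.
  rewrite ge0_fin_numE//; apply: le_lt_trans (key 4^-1 _) (ltry _).
  by apply/andP; split; lra.
rewrite -(fineK AE) -(fineK bE) lee_fin.
apply: lim_at0_ge => s hs; rewrite -lee_fin fineK//; exact: key.
Qed.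

(** * First moments *)

Lemma box_lscZ (R : realType) (n : nat) (c : R) (g : 'rV[R]_n -> R) :
  0 <= c -> (forall x, 0 <= g x) -> box_lsc (EFin \o g) ->
  box_lsc (fun x => (c * g x)%:E).
Proof.
by move=> c0 g0 lg; apply: (@box_lscM _ _ (cst c) g) => //; exact: box_lsc_cst.
Qed.

Lemma iint_lsc_hull1 (R : realType) (n : nat) (f : 'rV[R]_n -> R) p (d m : R) :
  log_concave f -> (iint (fun x => (f x)%:E) < +oo)%E ->
  0 < d -> 0 < m -> (forall y, box p d y -> m <= f y) ->
  iint (fun x => (f x)%:E) = iint (fun x => (lsc_hull f x)%:E).
Proof.
move=> lf If d0 m0 hm.
have := @iint_lsc_hull _ _ f (cst 1) p d m 0 lf If d0 m0 hm.
under [fun x => (cst 1 x * f x)%:E]funext do rewrite mul1r.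
under [fun x => (cst 1 x * lsc_hull f x)%:E]funext do rewrite mul1r.
apply => // [|x s /andP[s0 s1]]; first exact: box_lsc_cst.
by rewrite mulr0 addr0 mulr1 invf_ge1 ?subr_gt0// lerBlDr lerDl ltW.
Qed.

(** The coordinate satisfies [(1 - s) * x_i = z_i - s * p_i] at the contracted point [z], so the
    weight error is at most [s] times the absolute value of [p_i]. *)
Lemma iint_lsc_hull_max (R : realType) (n : nat) (f : 'rV[R]_n -> R) p (d m : R) i :
  log_concave f -> (iint (fun x => (f x)%:E) < +oo)%E ->
  0 < d -> 0 < m -> (forall y, box p d y -> m <= f y) ->
  iint (fun x => (Num.max (x ord0 i) 0 * f x)%:E) =
    iint (fun x => (Num.max (x ord0 i) 0 * lsc_hull f x)%:E) /\
  iint (fun x => (Num.max (- x ord0 i) 0 * f x)%:E) =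
    iint (fun x => (Num.max (- x ord0 i) 0 * lsc_hull f x)%:E).
Proof.
move=> lf If d0 m0 hm; split.
  apply: (iint_lsc_hull (c := `|p ord0 i|) lf If d0 m0 hm).
  - by move=> x; rewrite le_max lexx orbT.
  - exact: box_lsc_maxr.
  - by [].
  - move=> x s /andP[s0 s1]; rewrite ler_pdivlMl ?subr_gt0// !mxE.
    have := ler_norm (- p ord0 i); rewrite normrN => h.
    have : s * - p ord0 i <= s * `|p ord0 i| by rewrite ler_pM2l.
    have : 0 <= s * `|p ord0 i| by rewrite mulr_ge0// ltW.
    have := mulr_ge0 (_ : 0 <= 1 - s); rewrite subr_ge0 => /(_ _ (ltW s1)) h1.
    by rewrite !maxEle; case: ifP => ?; case: ifP => ?; lra.
apply: (iint_lsc_hull (c := `|p ord0 i|) lf If d0 m0 hm).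
- by move=> x; rewrite le_max lexx orbT.
- exact: box_lsc_maxrN.
- by [].
- move=> x s /andP[s0 s1]; rewrite ler_pdivlMl ?subr_gt0// !mxE.
  have := ler_norm (p ord0 i) => h.
  have : s * p ord0 i <= s * `|p ord0 i| by rewrite ler_pM2l.
  have : 0 <= s * `|p ord0 i| by rewrite mulr_ge0// ltW.
  by rewrite !maxEle; case: ifP => ?; case: ifP => ?; lra.
Qed.

Lemma box_lsc_sum (R : realType) (n : nat) (I : Type) (r : seq I)
    (F : I -> 'rV[R]_n -> R) :
  (forall i, box_lsc (EFin \o F i)) -> box_lsc (fun x => (\sum_(i <- r) F i x)%:E).
Proof.
move=> lF; elim: r => [|i r IH].
  by move=> x a h; exists 1 => // y _; move: h; rewrite !big_nil.
move=> x a; rewrite big_cons => h.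
have [d d0 hd] := box_lscD (lF i) IH (x := x) (a := a) h.
by exists d => // y /hd; rewrite big_cons.
Qed.

Lemma iint_sum (R : realType) (n : nat) (I : Type) (r : seq I)
    (F : I -> 'rV[R]_n -> R) :
  (forall i x, 0 <= F i x) -> (forall i, box_lsc (EFin \o F i)) ->
  iint (fun x => (\sum_(i <- r) F i x)%:E) =
    (\sum_(i <- r) iint (fun x => (F i x)%:E))%E.
Proof.
move=> F0 lF; elim: r => [|i r IH].
  rewrite big_nil; under [fun x => _]funext do rewrite big_nil.
  elim: {F F0 lF} n => [//|n IH] /=.
  by apply: integral0_eq => t _; exact: IH.
rewrite big_cons -IH -iintD.
- by congr iint; apply/funext => x; rewrite big_cons.
- by move=> x; rewrite lee_fin.
- by move=> x; rewrite lee_fin sumr_ge0.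
- exact: lF.
- exact: box_lsc_sum.
Qed.

(** For [a] and [b] the positive and negative parts of a vector [c], this dominates the positive
    part of [c . x], and exchanging them gives the part to subtract. The split is made coordinate by
    coordinate, because the barycenter hypothesis is. *)
Definition pos_neg_part (R : realType) (n : nat) (a b x : 'rV[R]_n) : R :=
  \sum_i (a ord0 i * Num.max (x ord0 i) 0 + b ord0 i * Num.max (- x ord0 i) 0).

Lemma iint_pos_neg_part (R : realType) (n : nat) (g : 'rV[R]_n -> R) (a b : 'rV[R]_n) :
  (forall x, 0 <= g x) -> box_lsc (EFin \o g) ->
  (forall i, 0 <= a ord0 i) -> (forall i, 0 <= b ord0 i) ->
  iint (fun x => (pos_neg_part a b x * g x)%:E) =
   (\sum_i ((a ord0 i)%:E * iint (fun x => (Num.max (x ord0 i) 0 * g x)%:E) +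
            (b ord0 i)%:E * iint (fun x => (Num.max (- x ord0 i) 0 * g x)%:E)))%E.
Proof.
move=> g0 lg a0 b0.
have m0 (t : R) : 0 <= Num.max t 0 by rewrite le_max lexx orbT.
have l1 i : box_lsc (fun x : 'rV[R]_n => (Num.max (x ord0 i) 0 * g x)%:E).
  by apply: box_lscM => //; exact: box_lsc_maxr.
have l2 i : box_lsc (fun x : 'rV[R]_n => (Num.max (- x ord0 i) 0 * g x)%:E).
  by apply: box_lscM => //; exact: box_lsc_maxrN.
have p1 i (x : 'rV[R]_n) : 0 <= Num.max (x ord0 i) 0 * g x by rewrite mulr_ge0.
have p2 i (x : 'rV[R]_n) : 0 <= Num.max (- x ord0 i) 0 * g x by rewrite mulr_ge0.
have k1 i : box_lsc (EFin \o (fun x : 'rV[R]_n => a ord0 i * (Num.max (x ord0 i) 0 * g x))).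
  by apply: box_lscZ (a0 i) (p1 i) (l1 i).
have k2 i : box_lsc (EFin \o (fun x : 'rV[R]_n => b ord0 i * (Num.max (- x ord0 i) 0 * g x))).
  by apply: box_lscZ (b0 i) (p2 i) (l2 i).
transitivity (iint (fun x => (\sum_i (a ord0 i * (Num.max (x ord0 i) 0 * g x) +
   b ord0 i * (Num.max (- x ord0 i) 0 * g x)))%:E)).
  congr iint; apply/funext => x; congr EFin; rewrite /pos_neg_part mulr_suml.
  by apply: eq_bigr => i _; ring.
rewrite iint_sum.
- apply: eq_bigr => i _.
  rewrite (@iintD _ _ (EFin \o (fun x : 'rV[R]_n => a ord0 i * (Num.max (x ord0 i) 0 * g x)))
    (EFin \o (fun x : 'rV[R]_n => b ord0 i * (Num.max (- x ord0 i) 0 * g x))))//.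
  + congr (_ + _)%E.
      by rewrite -iintZ// => x; rewrite lee_fin.
    by rewrite -iintZ// => x; rewrite lee_fin.
  + by move=> x; rewrite lee_fin mulr_ge0.
  + by move=> x; rewrite lee_fin mulr_ge0.
- by move=> i x; rewrite addr_ge0// mulr_ge0.
- by move=> i; exact: box_lscD.
Qed.

Lemma pos_neg_part_dotr (R : realType) (n : nat) (b x : 'rV[R]_n) :
  let bp := \row_i Num.max (b ord0 i) 0 in
  let bn := \row_i Num.max (- b ord0 i) 0 in
  pos_neg_part bp bn x = dotr b x + pos_neg_part bn bp x.
Proof.
rewrite /pos_neg_part /dotr -big_split/=; apply: eq_bigr => i _.
by rewrite !mxE !maxEle; case: ifP => h1; case: ifP => h2; case: ifP => h3; case: ifP => h4; nra.
Qed.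

(** * Log-concave functions with barycenter at the origin *)

(* A lower semicontinuous substitute for [c] times the indicator of a box. *)
Lemma box_bump (R : realType) (n : nat) (p : 'rV[R]_n) (d c : R) :
  0 < d -> 0 <= c -> exists G : 'rV[R]_n -> R,
  [/\ forall y, 0 <= G y <= c, forall y, ~ box p d y -> G y = 0,
      box_lsc (EFin \o G) & ((c * d ^+ n)%:E <= iint (EFin \o G))%E].
Proof.
move=> d0 c0; pose F (y : 'rV[R]_n) := if `[< box p d y >] then c else 0.
have F0 y : 0 <= F y by rewrite /F; case: ifP.
have d20 : 0 < d / 2 by rewrite divr_gt0.
exists (lsc_hull F); split.
- move=> y; rewrite lsc_hull_ge0//= (le_trans (lsc_hull_le F0 y))// /F.
  by case: ifP.
- move=> y ny; apply/le_anti; rewrite lsc_hull_ge0// andbT.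
  by rewrite (le_trans (lsc_hull_le F0 y))// /F asboolF.
- exact: lsc_hull_lsc.
- rewrite (_ : d = 2 * (d / 2)); last by field.
  apply: (iint_box (x := p)) => //.
    by move=> y; rewrite lee_fin lsc_hull_ge0.
  move=> y hy; rewrite lee_fin; apply: (lsc_hull_ge F0 (d := d / 2)) => // z hz.
  rewrite /F asboolT// => i; have -> : z ord0 i - p ord0 i =
    (z ord0 i - y ord0 i) + (y ord0 i - p ord0 i) by ring.
  by apply: le_lt_trans (ler_normD _ _) _; have := hy i; have := hz i; lra.
Qed.

Lemma dotrDr (R : realType) (n : nat) (b x y : 'rV[R]_n) :
  dotr b (x + y) = dotr b x + dotr b y.
Proof. by rewrite /dotr -big_split; apply: eq_bigr => i _; rewrite mxE mulrDr. Qed.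

Lemma dotrNr (R : realType) (n : nat) (b x : 'rV[R]_n) :
  dotr b (- x) = - dotr b x.
Proof. by rewrite /dotr -sumrN; apply: eq_bigr => i _; rewrite mxE mulrN. Qed.

Lemma absorb_box (R : realType) (n : nat) (x : 'rV[R]_n) (d : R) :
  0 < d -> exists2 t, 0 < t & box 0 d (t^-1 *: x).
Proof.
move=> d0; pose D := 1 + \sum_i `|x ord0 i|.
have D1 : 0 < D by rewrite ltr_wpDr// sumr_ge0.
exists (D / d); first by rewrite divr_gt0.
move=> i; rewrite !mxE subr0 normrM ger0_norm ?invr_ge0 ?divr_ge0 ?(ltW D1) ?(ltW d0)//.
rewrite invf_div mulrAC ltr_pdivrMr// ltr_pM2l// /D (bigD1 i)//=.
have : 0 <= \sum_(j < n | j != i) `|x ord0 j| by rewrite sumr_ge0.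
lra.
Qed.

Section barycenter.
Context (R : realType) (n : nat) (f : 'rV[R]_n -> R).
Hypotheses (lcf : log_concave f) (If0 : (0 < iint (fun x => (f x)%:E))%E)
  (Ify : (iint (fun x => (f x)%:E) < +oo)%E) (bf : barycenter_origin f).

Let f0 : forall x, 0 <= f x. Proof. by case: lcf. Qed.
Let g := lsc_hull f.
Let g0 : forall x, 0 <= g x. Proof. exact: lsc_hull_ge0. Qed.
Let gf : forall x, g x <= f x. Proof. exact: lsc_hull_le. Qed.
Let lg : box_lsc (EFin \o g). Proof. exact: lsc_hull_lsc. Qed.

Let maxr0 (t : R) : 0 <= Num.max t 0. Proof. by rewrite le_max lexx orbT. Qed.

Let pnp0 (a b x : 'rV[R]_n) : (forall i, 0 <= a ord0 i) -> (forall i, 0 <= b ord0 i) ->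
  0 <= pos_neg_part a b x.
Proof. by move=> a0 b0; apply: sumr_ge0 => i _; rewrite addr_ge0// mulr_ge0. Qed.

Let pnp_lsc (a b : 'rV[R]_n) : (forall i, 0 <= a ord0 i) -> (forall i, 0 <= b ord0 i) ->
  box_lsc (EFin \o (fun x => pos_neg_part a b x)).
Proof.
move=> a0 b0; apply: box_lsc_sum => i; apply: box_lscD.
  by apply: (box_lscZ (a0 i)) => //; exact: box_lsc_maxr.
by apply: (box_lscZ (b0 i)) => //; exact: box_lsc_maxrN.
Qed.

(** The two moments of each coordinate agree and are finite, for [f] and hence for its hull; both
    integrals are therefore the sum of these moments weighted by the absolute values of the [b_i].
    Finiteness is what later allows [K] to be cancelled. *)
Lemma barycenter_balance (b : 'rV[R]_n) :
  let bp := \row_i Num.max (b ord0 i) 0 in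
  let bn := \row_i Num.max (- b ord0 i) 0 in
  exists K : R, iint (fun x => (pos_neg_part bp bn x * g x)%:E) = K%:E /\
    iint (fun x => (pos_neg_part bn bp x * g x)%:E) = K%:E.
Proof.
move=> bp bn; have [p [d [m [d0 m0 hm]]]] := iint_gt0_box lcf If0.
have bp0 i : 0 <= bp ord0 i by rewrite mxE.
have bn0 i : 0 <= bn ord0 i by rewrite mxE.
have fin i : exists A : R,
    iint (fun x : 'rV[R]_n => (Num.max (x ord0 i) 0 * g x)%:E) = A%:E /\
    iint (fun x : 'rV[R]_n => (Num.max (- x ord0 i) 0 * g x)%:E) = A%:E.
  have [<- <-] := iint_lsc_hull_max i lcf Ify d0 m0 hm.
  have [h1 [h2 <-]] := bf i.
  exists (fine (iint (fun x => (Num.max (x ord0 i) 0 * f x)%:E))).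
  rewrite fineK// ge0_fin_numE//; apply: iint_ge0 => x.
  by rewrite lee_fin mulr_ge0.
have [A hA] := choice fin.
exists (\sum_i (bp ord0 i * A i + bn ord0 i * A i)).
split; rewrite iint_pos_neg_part// -sumEFin; apply: eq_bigr => i _;
  have [-> ->] := hA i; rewrite -!EFinM -EFinD//.
by rewrite addrC.
Qed.

Lemma origin_interior : exists d m, [/\ 0 < d, 0 < m & forall y, box 0 d y -> m <= f y].
Proof.
have [p [d [m [d0 m0 hm]]]] := iint_gt0_box lcf If0.
have [[s [s0 fs]]|no] := pselect (exists s, 0 < s /\ 0 < f (- s *: p)).
  (* The weight for which [- s *: p] and [p] average to 0. *)
  pose w := s / (1 + s); have s10 : 0 < 1 + s by lra.
  have w0 : 0 < w by rewrite divr_gt0.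
  have w1 : w < 1 by rewrite ltr_pdivrMr//; lra.
  exists (w * d), (f (- s *: p) `^ (1 - w) * m `^ w); split.
  - by rewrite mulr_gt0.
  - by rewrite mulr_gt0// powR_gt0.
  move=> y hy; apply: (log_concave_contract (p := p) (d := d)) => //.
    by rewrite w0.
  rewrite scalerA -scalerDl (_ : _ + _ = 0) ?scale0r//.
  by rewrite /w; field; rewrite gt_eqF.
(* Separating [0] from the set where [f] is positive contradicts the barycenter. *)
exfalso.
pose S := [set x | 0 < f (p + x)].
(* The functional is at most 1 on [S] and at least 1 at [- p]; undoing the translation by [p], it is
   nonpositive wherever [f] is positive. *)
have [||//||b [bS bp]] := @convex_hahn_banach R n S (cst 1) (- p) 1.
- move=> x y w Sx Sy /andP[w0 w1]; split; last by rewrite /=; lra.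
  rewrite /S/=; have -> : p + (w *: x + (1 - w) *: y) =
     (1 - (1 - w)) *: (p + x) + (1 - w) *: (p + y).
    by apply/rowP => i; rewrite !mxE; ring.
  have w01 : 0 <= 1 - w <= 1 by apply/andP; split; lra.
  apply: lt_le_trans (proj2 lcf _ _ _ w01).
  by rewrite mulr_gt0// powR_gt0.
- move=> x; have [t t0 ht] := absorb_box x d0; exists t => //.
  rewrite /S/=; apply: lt_le_trans m0 (hm _ _) => i.
  by rewrite mxE addrAC subrr add0r; have := ht i; rewrite [X in _ - X]mxE subr0.
- move=> t t0; rewrite /S/= mulr1 => ft; rewrite leNgt; apply/negP => t1.
  apply: no; exists ((1 - t) / t); split; first by rewrite divr_gt0//; lra.
  rewrite (_ : _ *: p = p + t^-1 *: - p)//.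
  by apply/rowP => i; rewrite !mxE; field; rewrite gt_eqF.
pose B := 1 + \sum_i `|b ord0 i|.
have B0 : 0 < B by rewrite ltr_wpDr// sumr_ge0.
pose e := Num.min (d / 2) (2 * B)^-1.
(* This radius lets [b] vary by at most 1/2 around [p], where it is at most -1; the bound [d / 2]
   leaves room for a neighbourhood on which the hull stays above [m]. *)
have e0 : 0 < e by rewrite lt_min divr_gt0//= invr_gt0 mulr_gt0.
rewrite dotrNr in bp.
have bneg x : 0 < f x -> dotr b x <= 0.
  move=> fx; have := bS (x - p); rewrite /S/= addrC subrK => /(_ fx).
  by rewrite dotrDr dotrNr; lra.
have bbox y : box p e y -> dotr b y <= - 2^-1.
  move=> hy; have -> : y = p + (y - p) by rewrite addrC subrK.
  rewrite dotrDr; suff : dotr b (y - p) <= 2^-1 by lra.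
  apply: (@le_trans _ _ (\sum_i `|b ord0 i| * e)).
    apply: ler_sum => i _; apply: le_trans (ler_norm _) _; rewrite normrM.
    by rewrite ler_wpM2l// ltW//; have := hy i; rewrite !mxE.
  rewrite -mulr_suml; apply: (@le_trans _ _ (B * (2 * B)^-1)).
    apply: ler_pM => //; [exact: sumr_ge0|exact: ltW|by rewrite /B lerDr|].
    by rewrite ge_min lexx orbT.
  by rewrite le_eqVlt; apply/orP; left; apply/eqP; field; rewrite gt_eqF.
have gbox y : box p e y -> m <= g y.
  move=> hy; have d20 : 0 < d / 2 by rewrite divr_gt0.
  apply: (lsc_hull_ge f0 (ltW m0) d20) => z hz; apply: hm => i.
  have -> : z ord0 i - p ord0 i = (z ord0 i - y ord0 i) + (y ord0 i - p ord0 i) by ring.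
  apply: le_lt_trans (ler_normD _ _) _; have := hz i; have := hy i.
  by rewrite lt_min => /andP[? _]; lra.
have [K [K1 K2]] := barycenter_balance b.
have [G [G01 G0 lG IG]] := @box_bump R n p e (m / 2) e0 (ltW (divr_gt0 m0 (ltr0Sn _ _))).
pose P := pos_neg_part (\row_i Num.max (b ord0 i) 0) (\row_i Num.max (- b ord0 i) 0).
pose N := pos_neg_part (\row_i Num.max (- b ord0 i) 0) (\row_i Num.max (b ord0 i) 0).
have P0 x : 0 <= P x by apply: pnp0 => i; rewrite mxE.
have lP : box_lsc (EFin \o P) by apply: pnp_lsc => i; rewrite mxE.
have Gge0 x : 0 <= G x by case/andP: (G01 x).
(* On the box [dotr b x * g x] is at most [- m / 2], which pays for the bump [G]; after integration
   the common value [K] cancels and leaves a positive number below 0. *)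
have : (iint (fun x => (P x * g x)%:E + (G x)%:E) <= iint (fun x => (N x * g x)%:E))%E.
  apply: le_iint => x; first by rewrite -EFinD lee_fin addr_ge0// mulr_ge0.
  rewrite -EFinD lee_fin /P pos_neg_part_dotr -/N mulrDl.
  suff : dotr b x * g x + G x <= 0 by lra.
  have [hx|hx] := pselect (box p e x).
    have := bbox _ hx; have := gbox _ hx; have /andP[_] := G01 x => h1 h2 h3.
    have : dotr b x * g x <= - 2^-1 * g x by rewrite ler_wpM2r.
    lra.
  rewrite G0// addr0.
  have := f0 x; rewrite le_eqVlt => /predU1P[fx|fx].
    have : g x = 0 by apply/le_anti; rewrite g0 andbT (le_trans (gf x))// -fx.
    by move=> ->; rewrite mulr0.
  by rewrite mulr_le0_ge0// bneg.
rewrite (@iintD _ _ (fun x => (P x * g x)%:E) (EFin \o G))//; last 2 first.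
- by move=> x; rewrite lee_fin mulr_ge0.
- exact: box_lscM.
rewrite K1 K2 => h.
have : (K%:E + (m / 2 * e ^+ n)%:E <= K%:E)%E.
  by apply: le_trans h; rewrite leeD2l.
by rewrite -EFinD lee_fin gerDl leNgt mulr_gt0// ?exprn_gt0// divr_gt0.
Qed.

(** With [L = ln (m / f 0)], the integrated tangent inequality reads [1 + s L <= (1 - s)^-n <= e].
    Hence [L <= (n + 1) (e - 1) <= 2 e n], the origin of the constant [expR (2 * expR 1)]. *)
Lemma box_value_le p d m : (0 < n)%N ->
  0 < d -> 0 < m -> (forall y, box p d y -> m <= f y) ->
  m <= expR (2 * expR 1) ^+ n * f 0.
Proof.
move=> n0 d0 m0 hm; have [d1 [m1 [d10 m10 hm1]]] := origin_interior.
have f00 : 0 < f 0 by apply: lt_le_trans m10 (hm1 _ (box_center _ _)).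
have M1 : 1 <= expR (2 * expR 1) ^+ n :> R.
  by rewrite exprn_ege1// -expR0 ler_expR mulr_ge0// expR_ge0.
have [mf|fm] := leP m (f 0).
  by apply: le_trans mf _; rewrite ler_peMl// ltW.
pose S := [set x | 0 < f x].
have [||||b [bS _]] := @convex_hahn_banach R n S (fun x => ln (f 0) - ln (f x)) 0 0.
- move=> x y w Sx Sy /andP[w0 w1].
  have w01 : 0 <= 1 - w <= 1 by apply/andP; split; lra.
  have := proj2 lcf x y _ w01; rewrite subKr => h.
  have h0 : 0 < f x `^ w * f y `^ (1 - w) by rewrite mulr_gt0// powR_gt0.
  split; first exact: lt_le_trans h.
  have : ln (f x `^ w * f y `^ (1 - w)) <= ln (f (w *: x + (1 - w) *: y)).
    by rewrite ler_ln ?posrE//; exact: lt_le_trans h.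
  by rewrite lnM ?posrE ?powR_gt0// !ln_powR; lra.
- move=> x; have [t t0 ht] := absorb_box x d10; exists t => //.
  exact: lt_le_trans m10 (hm1 _ ht).
- by rewrite subrr.
- by move=> t t0 _; rewrite scaler0 subrr mulr0.
(* [1 - s = n / (n + 1)] keeps the Jacobian [(1 - s) ^- n] below [e]. *)
pose s : R := n.+1%:R^-1.
have s0 : 0 < s by rewrite invr_gt0.
have s1 : s < 1 by rewrite invf_lt1 ?ltr1n// ltr0n.
have s01 : 0 < s < 1 by rewrite s0.
pose L := ln m - ln (f 0).
have L0 : 0 <= L by rewrite subr_ge0 ler_ln ?posrE// ltW.
have [K [K1 K2]] := barycenter_balance b.
pose P := pos_neg_part (\row_i Num.max (b ord0 i) 0) (\row_i Num.max (- b ord0 i) 0).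
pose N := pos_neg_part (\row_i Num.max (- b ord0 i) 0) (\row_i Num.max (b ord0 i) 0).
have P0 x : 0 <= P x by apply: pnp0 => i; rewrite mxE.
have lP : box_lsc (EFin \o P) by apply: pnp_lsc => i; rewrite mxE.
have N0 x : 0 <= N x by apply: pnp0 => i; rewrite mxE.
have lN : box_lsc (EFin \o N) by apply: pnp_lsc => i; rewrite mxE.
(* Writing [f x ^ (1 - s) m ^ s] as [f x] times an exponential, the bound [1 + t <= expR t] and the
   subgradient inequality give the factor [1 + s (L + b . x)]; [P] and [N] then carry [b . x]
   without signs. *)
have pw x : (1 + s * L) * g x + s * (P x * g x) <=
    g ((1 - s) *: x + s *: p) + s * (N x * g x).
  rewrite /P pos_neg_part_dotr -/N.
  suff : (1 + s * (L + dotr b x)) * g x <= g ((1 - s) *: x + s *: p) by lra.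
  have [c0|c0] := ltP (1 + s * (L + dotr b x)) 0.
    by apply: le_trans (g0 _); rewrite nmulr_rle0.
  have := g0 x; rewrite le_eqVlt => /predU1P[<-|gx]; first by rewrite mulr0.
  have fx : 0 < f x by exact: lt_le_trans (gf x).
  apply: le_trans (lsc_hull_contract x lcf d0 m0 hm s01).
  apply: (@le_trans _ _ ((1 + s * (L + dotr b x)) * f x)); first by rewrite ler_wpM2l.
  have -> : f x `^ (1 - s) * m `^ s = f x * expR (s * (ln m - ln (f x))).
    transitivity (expR (ln (f x)) * expR (s * (ln m - ln (f x)))).
      by rewrite /powR !gt_eqF// -!expRD; congr (expR _); ring.
    by rewrite lnK ?posrE.
  rewrite mulrC ler_pM2l//; apply: le_trans (expR_ge1Dx _).
  rewrite lerD2l ler_pM2l//; have := bS x fx; rewrite /L; lra.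
pose I := iint (fun x => (g x)%:E).
have IE : I = iint (fun x => (f x)%:E) by rewrite (iint_lsc_hull1 lcf Ify d0 m0 hm).
have [J IJ] : exists J, I = J%:E.
  by exists (fine I); rewrite fineK// IE ge0_fin_numE// ltW.
have J0 : 0 < J by rewrite -lte_fin -IJ IE.
have sL0 : 0 <= 1 + s * L by rewrite addr_ge0// mulr_ge0// ltW.
have lZ c (h : 'rV[R]_n -> R) : 0 <= c -> (forall x, 0 <= h x) ->
    box_lsc (EFin \o h) -> box_lsc (fun x => (c * h x)%:E).
  exact: box_lscZ.
have ls : box_lsc (EFin \o (fun x => g ((1 - s) *: x + s *: p))).
  move=> x t /lg[e e0 he]; exists e => // y hy; apply: he => i.
  have := hy i; rewrite !mxE => hyi.
  have l0 : 0 < 1 - s by lra.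
  rewrite opprD addrACA subrr addr0 -mulrBr normrM ger0_norm ?(ltW l0)//.
  by apply: le_lt_trans hyi; rewrite ler_piMl//; lra.
have : (iint (fun x => (((1 + s * L) * g x)%:E + (s * (P x * g x))%:E)) <=
        iint (fun x => ((g ((1 - s) *: x + s *: p))%:E + (s * (N x * g x))%:E)))%E.
  apply: le_iint => x; last by rewrite -!EFinD lee_fin.
  by rewrite -EFinD lee_fin addr_ge0// mulr_ge0// ?mulr_ge0// ltW.
have lPg : box_lsc (fun x => (P x * g x)%:E) by exact: box_lscM.
have lNg : box_lsc (fun x => (N x * g x)%:E) by exact: box_lscM.
have Pg0 x : 0 <= P x * g x by rewrite mulr_ge0.
have Ng0 x : 0 <= N x * g x by rewrite mulr_ge0.
rewrite (@iintD _ _ (fun x => ((1 + s * L) * g x)%:E) (fun x => (s * (P x * g x))%:E)); last 4 first.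
- by move=> x; rewrite lee_fin mulr_ge0.
- by move=> x; rewrite lee_fin mulr_ge0// ltW.
- exact: lZ.
- by apply: lZ => //; exact: ltW.
rewrite (@iintD _ _ (fun x => (g ((1 - s) *: x + s *: p))%:E) (fun x => (s * (N x * g x))%:E)); last 4 first.
- by move=> x; rewrite lee_fin.
- by move=> x; rewrite lee_fin mulr_ge0// ltW.
- exact: ls.
- by apply: lZ => //; exact: ltW.
have l0 : 0 < 1 - s by lra.
have Eg0 x : (0 <= (EFin \o g) x)%E by rewrite /= lee_fin.
have EPg0 x : (0 <= (P x * g x)%:E)%E by rewrite lee_fin.
have ENg0 x : (0 <= (N x * g x)%:E)%E by rewrite lee_fin.
rewrite (@iint_affine _ _ (EFin \o g) (1 - s) (s *: p))//.
rewrite (@iintZ _ _ (EFin \o g) (1 + s * L))//.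
rewrite (@iintZ _ _ (fun x => (P x * g x)%:E) s) ?(ltW s0)//.
rewrite (@iintZ _ _ (fun x => (N x * g x)%:E) s) ?(ltW s0)//.
rewrite K1 K2 -/I IJ -!EFinM -!EFinD lee_fin lerD2r ler_pM2r// => h.
have hs : (1 - s) ^- n <= expR 1.
  have -> : (1 - s) ^- n = (1 + n%:R^-1) ^+ n.
    rewrite -exprVn; congr (_ ^+ _); rewrite /s -natr1; field.
    by rewrite pnatr_eq0 -lt0n n0 natr1 pnatr_eq0.
  have -> : expR 1 = expR (n%:R * n%:R^-1) :> R by rewrite divff// pnatr_eq0 -lt0n.
  rewrite expRM_natl lerXn2r ?nnegrE ?expR_ge0 ?addr_ge0 ?invr_ge0//.
  exact: expR_ge1Dx.
have Ln : L <= n.+1%:R * (expR 1 - 1).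
  have : s * L <= expR 1 - 1 by lra.
  by rewrite /s mulrC ler_pdivrMr// mulrC.
have n1 : 1 <= n%:R :> R by rewrite ler1n.
have Ln2 : L <= n%:R * (2 * expR 1).
  apply: le_trans Ln _; rewrite -natr1.
  have e1 : 1 <= expR 1 :> R by rewrite -expR0 ler_expR.
  have : 0 <= (n%:R - 1) * expR 1 :> R by rewrite mulr_ge0// ?subr_ge0// expR_ge0.
  lra.
rewrite -(lnK (x := m)) ?posrE// -(lnK (x := f 0)) ?posrE//.
by rewrite -expRM_natl -expRD ler_expR -lerBlDr.
Qed.

(** [f] may drop abruptly next to [x], so the box bound is applied at [(1 - s) *: x], around which
    [f] is controlled, and [s] tends to 0. *)
Lemma le_value_origin x : (0 < n)%N -> f x <= expR (2 * expR 1) ^+ n * f 0.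
Proof.
move=> n0; have [d [m [d0 m0 hm]]] := origin_interior.
have f00 : 0 < f 0 by apply: lt_le_trans m0 (hm _ (box_center _ _)).
have := f0 x; rewrite le_eqVlt => /predU1P[<-|fx].
  by rewrite mulr_ge0 ?exprn_ge0 ?expR_ge0.
set T := _ * f 0.
have T0 : 0 < T by rewrite mulr_gt0 ?exprn_gt0 ?expR_gt0.
rewrite -(ler_ln (x := f x)) ?posrE//.
apply: (@lim_at0_ge _ _ 0 _ (ln (f x) - ln m)) => s /andP[s0 s2].
rewrite mul0r expR0 mul1r.
have s01 : 0 < s < 1 by apply/andP; split; lra.
have v0 : 0 < f x `^ (1 - s) * m `^ s by rewrite mulr_gt0// powR_gt0.
have : ln (f x `^ (1 - s) * m `^ s) <= ln T.
  rewrite ler_ln ?posrE//.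
  apply: (@box_value_le ((1 - s) *: x + s *: 0) (s * d)) => //.
    by rewrite mulr_gt0.
  by move=> y; exact: log_concave_contract.
by rewrite lnM ?posrE ?powR_gt0// !ln_powR; lra.
Qed.

(** Through log-concavity a single strict drop forces exponential decay, which makes the radial
    integral on the ray finite. *)
Lemma ray_decay x : (0 < n)%N -> x != 0 -> exists2 r, 0 < r & f (r *: x) < f 0.
Proof.
move=> n0 x0; have [d [m [d0 m0 hm]]] := origin_interior.
have f00 : 0 < f 0 by apply: lt_le_trans m0 (hm _ (box_center _ _)).
apply: contrapT => no.
have fr r : 0 <= r -> f 0 <= f (r *: x).
  rewrite le_eqVlt => /predU1P[<-|r0]; first by rewrite scale0r.
  by rewrite leNgt; apply/negP => h; apply: no; exists r.
have [i xi] : exists i, x ord0 i != 0.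
  apply/existsP; rewrite -negb_forall; apply: contra x0 => /forallP h.
  by apply/eqP/rowP => i; rewrite mxE; apply/eqP.
(* Otherwise [f >= c] on infinitely many disjoint boxes along the ray. *)
pose c := Num.min m (f 0).
have c0 : 0 < c by rewrite lt_min m0.
pose r (k : nat) := k%:R * (d / `|x ord0 i|).
have xi0 : 0 < `|x ord0 i| by rewrite normr_gt0.
have r0 k : 0 <= r k by rewrite mulr_ge0// divr_ge0// ltW.
(* [y] is the midpoint of [(2 * r k) *: x] on the ray and a point of the box around 0. *)
have fb k y : box (r k *: x) (d / 2) y -> c <= f y.
  move=> hy; have -> : y = (1 - 2^-1) *: ((2 * r k) *: x) + 2^-1 *: (2 *: (y - r k *: x)).
    by apply/rowP => j; rewrite !mxE; field.
  have h01 : 0 <= (2^-1 : R) <= 1 by apply/andP; split; lra.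
  apply: (log_concave_ge_min lcf (ltW c0) h01).
    by apply: le_trans (fr _ _); rewrite ?ge_min ?lexx ?orbT// mulr_ge0.
  apply: le_trans (hm _ _); first by rewrite ge_min lexx.
  move=> j; have := hy j; rewrite !mxE subr0 => hj.
  by rewrite normrM ger0_norm//; lra.
have d20 : 0 < d / 2 by rewrite divr_gt0.
have [G hG] := choice (fun k => @box_bump R n (r k *: x) (d / 2) c d20 (ltW c0)).
have G0 k y : 0 <= G k y by have [/(_ y)/andP[]] := hG k.
have disj k l y : k != l -> box (r k *: x) (d / 2) y -> box (r l *: x) (d / 2) y -> False.
  move=> kl /(_ i) hk /(_ i) hl.
  rewrite !mxE in hk hl.
  have : `|r k * x ord0 i - r l * x ord0 i| < d.
    have -> : r k * x ord0 i - r l * x ord0 i =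
      (y ord0 i - r l * x ord0 i) - (y ord0 i - r k * x ord0 i) by ring.
    by apply: le_lt_trans (ler_normB _ _) _; lra.
  rewrite -mulrBl /r -mulrBl 2!normrM [`|d / _|]ger0_norm ?divr_ge0 ?(ltW d0)//.
  rewrite -mulrA divfK ?gt_eqF//.
  rewrite ltNge ler_peMl ?(ltW d0)//.
  have : 1 <= `|(k : int)%:~R - (l : int)%:~R| :> R.
    by rewrite -intrB -intr_norm ler1z -gtz0_ge1 normr_gt0 subr_eq0 eqz_nat.
  by rewrite -!pmulrn.
have sumle N y : \sum_(k < N) G k y <= f y.
  have [[k hk]|nok] := pselect (exists k : 'I_N, box (r k *: x) (d / 2) y).
    rewrite (bigD1 k)//= big1 ?addr0 => [|l lk].
      apply: le_trans (fb k y hk).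
      by have [/(_ y)/andP[]] := hG k.
    have [_ h _ _] := hG l; apply: h => hl; apply: disj hl hk.
    by move: lk; rewrite -(inj_eq val_inj).
  rewrite big1// => k _; have [_ h _ _] := hG k; apply: h => hk.
  by apply: nok; exists k.
have IfE : iint (fun x => (f x)%:E) \is a fin_num by rewrite ge0_fin_numE// ltW.
set I := iint _ in IfE.
have key N : N%:R * (c * (d / 2) ^+ n) <= fine I.
  rewrite -lee_fin fineK//.
  apply: (@le_trans _ _ (iint (fun y => (\sum_(k < N) G k y)%:E))); last first.
    by apply: le_iint => y; rewrite lee_fin ?sumr_ge0.
  rewrite iint_sum//; last by move=> k; have [] := hG k.
  have -> : (N%:R * (c * (d / 2) ^+ n))%:E = (\sum_(k < N) (c * (d / 2) ^+ n)%:E)%E.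
    by rewrite sumEFin sumr_const card_ord mulr_natl.
  by apply: lee_sum => k _; have [] := hG k.
have v0 : 0 < c * (d / 2) ^+ n by rewrite mulr_gt0// exprn_gt0.
have I0 : 0 <= fine I / (c * (d / 2) ^+ n).
  by rewrite divr_ge0 ?(ltW v0)// fine_ge0// ltW.
have := archi_boundP I0; rewrite ltr_pdivrMr// => h.
by have := lt_le_trans h (key _); rewrite ltxx.
Qed.

End barycenter.

(** * Log-concave densities on a half-line *)

Definition weighted_measure (R : realType) (w : R -> R) : set (measurableTypeR R) -> \bar R :=
  fun A => (\int[@lebesgue_measure R]_(t in A) (w t)%:E)%E.

Section weighted_measure.
Context (R : realType) (w : R -> R).
Hypotheses (mw : measurable_fun (setT : set (measurableTypeR R)) w) (w0 : forall t, 0 <= w t).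

Let mEw : measurable_fun (setT : set (measurableTypeR R)) (EFin \o w).
Proof. exact/measurable_EFinP. Qed.

Let Ew0 t : (0 <= (w t)%:E)%E. Proof. by rewrite lee_fin. Qed.

Let weighted0 : weighted_measure w set0 = 0%E.
Proof. exact: integral_set0. Qed.

Let weighted_ge0 A : (0 <= weighted_measure w A)%E.
Proof. by apply: integral_ge0. Qed.

Lemma weighted_sigma_additive : semi_sigma_additive (weighted_measure w).
Proof.
move=> F mF tF mUF; rewrite /weighted_measure ge0_integral_bigcup//=; last exact: measurable_funTS.
by apply: is_cvg_ereal_nneg_natsum_cond => // n _ _; exact: integral_ge0.
Qed.

HB.instance Definition _ := isMeasure.Build _ _ _ (weighted_measure w)
  weighted0 weighted_ge0 weighted_sigma_additive.

Local Open Scope ereal_scope.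

Import HBNNSimple.

Let nu : {measure set (measurableTypeR R) -> \bar R} := weighted_measure w.

Lemma integral_weighted_indic (A : set (measurableTypeR R)) : measurable A ->
  \int[nu]_x (\1_A x)%:E = \int[@lebesgue_measure R]_x ((w x)%:E * (\1_A x)%:E).
Proof.
move=> mA; rewrite integral_indic// setIT /nu /= /weighted_measure integral_mkcond.
apply: eq_integral => t _; rewrite patchE indicE; case: ifPn => _.
  by rewrite mule1.
by rewrite mule0.
Qed.

Lemma integral_weighted_nnsfun (h : {nnsfun (measurableTypeR R) >-> R}) :
  \int[nu]_x (h x)%:E = \int[@lebesgue_measure R]_x ((w x)%:E * (h x)%:E).
Proof.
under [LHS]eq_integral do rewrite fimfunE -fsumEFin//.
rewrite [LHS]ge0_integral_fsum//; last 2 first.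
- by move=> r; exact/measurable_EFinP/measurableT_comp.
- by move=> r x _; rewrite EFinM nnfun_muleindic_ge0.
under [RHS]eq_integral.
  move=> x xD; rewrite fimfunE -fsumEFin// ge0_mule_fsumr; last first.
    by move=> r; rewrite EFinM nnfun_muleindic_ge0.
  over.
rewrite [RHS]ge0_integral_fsum//; last 2 first.
- move=> r; apply: emeasurable_funM => //; apply/measurable_EFinP; exact: measurableT_comp.
- by move=> r x _; rewrite mule_ge0// EFinM nnfun_muleindic_ge0.
apply: eq_fsbigr => r _.
under [RHS]eq_integral do rewrite EFinM muleCA.
have mi : measurable (h @^-1` [set r]) by exact: measurable_sfunP.
rewrite [LHS]integralZl_indic_nnsfun//= integral_weighted_indic//.
have [r0|r0] := leP 0%R r.
  rewrite ge0_integralZl//; last by move=> x _; rewrite mule_ge0.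
  by apply: emeasurable_funM => //; apply/measurable_EFinP; exact: measurable_indic.
rewrite preimage_nnfun0// !integral0_eq ?mule0// => x _;
  by rewrite indic0 ?mule0.
Qed.

Lemma ge0_integral_weighted (F : R -> \bar R) : measurable_fun setT F ->
  (forall t, 0 <= F t) ->
  \int[nu]_t F t = \int[@lebesgue_measure R]_t ((w t)%:E * F t).
Proof.
move=> mF F0; pose f_ := nnsfun_approx (@measurableT _ (measurableTypeR R)) mF.
transitivity (limn (fun n => \int[nu]_x (f_ n x)%:E)).
  rewrite -monotone_convergence//=.
  - apply: eq_integral => x _; apply/esym/cvg_lim => //=.
    exact: cvg_nnsfun_approx.
  - by move=> n; apply: measurableT_comp => //; exact: measurable_funTS.
  - by move=> n x _; rewrite lee_fin.
  - by move=> x _ a b ab; rewrite lee_fin//; exact/lefP/nd_nnsfun_approx.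
under eq_fun do rewrite integral_weighted_nnsfun.
rewrite -monotone_convergence//=.
- apply: eq_integral => x _; rewrite limeMl//.
    by congr (_ * _); apply/cvg_lim => //; exact: cvg_nnsfun_approx.
  by apply: (cvgP (F x)); exact: cvg_nnsfun_approx.
- move=> n; apply: emeasurable_funM => //.
  by apply: measurableT_comp => //; exact: measurable_funTS.
- by move=> n x _; rewrite mule_ge0// lee_fin.
- move=> x _ a b ab; rewrite lee_pmul// ?lee_fin//.
  exact/lefP/nd_nnsfun_approx.
Qed.

End weighted_measure.

(** The function is [s / (1 + d * s)] in partial fractions, which shows at once its derivative and
    its limit [d^-1] at infinity. *)
Lemma psi_derive (R : realType) (d x : R) : 0 < d -> 0 < x ->
  is_derive x 1 (fun s : R => d^-1 - (d * (1 + d * s))^-1) ((1 + d * x) ^- 2).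
Proof.
move=> d0 x0; have ux : 0 < 1 + d * x by rewrite ltr_pwDl// mulr_ge0// ltW.
pose g (s : R) : R := d * (1 + d * s).
have gx : g x != 0 by rewrite mulf_neq0// gt_eqF.
have h1 : is_derive x 1 g (d * d).
  apply: is_derive_eq; rewrite /GRing.scale/=; ring.
have h2 := is_deriveV gx h1.
have h3 : is_derive x 1 (fun s => d^-1 - (g s)^-1) (0 - (- (g x) ^- 2 *: (d * d))).
  apply: is_deriveB.
apply: (is_derive_eq h3).
rewrite /GRing.scale/= /g.
by field; rewrite !gt_eqF.
Qed.

Lemma psi_cvgy (R : realType) (d : R) : 0 < d ->
  (fun s : R => d^-1 - (d * (1 + d * s))^-1) x @[x --> +oo] --> d^-1.
Proof.
move=> d0; rewrite -[X in _ --> X]subr0; apply: cvgB; first exact: cvg_cst.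
apply/gtr0_cvgV0.
  near=> s.
  have s0 : 0 <= s by near: s; exact: nbhs_pinfty_ge.
  by rewrite mulr_gt0// ltr_pwDl// mulr_ge0// ltW.
apply: gt0_cvgMry => //; apply/cvgryPge => A; near=> s.
rewrite -lerBlDl -ler_pdivrMl//; near: s; exact: nbhs_pinfty_ge.
Unshelve. all: by end_near. Qed.

Lemma psi_cvg (R : realType) (d x : R) : 0 < d -> 0 <= x ->
  {for x, continuous (fun s : R => d^-1 - (d * (1 + d * s))^-1)}.
Proof.
move=> d0 x0; apply: cvgB; first exact: cvg_cst.
apply: cvgV; first by rewrite mulf_neq0// gt_eqF// ltr_pwDl// mulr_ge0// ltW.
apply: cvgM; first exact: cvg_cst.
by apply: cvgD; [exact: cvg_cst|apply: cvgM; [exact: cvg_cst|exact: cvg_id]].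
Qed.

(** The change of variable is [1 / r = 1 / s + d]. Both sides integrate [G] against a measure, and
    the two measures agree on open lower half-lines, which generate the Borel sets; there the
    fundamental theorem of calculus computes the masses. *)
Lemma harmonic_substitution (R : realType) (d : R) (G : R -> \bar R) :
  0 < d -> (forall t, 0 <= G t)%E -> measurable_fun setT G ->
  (\int[@lebesgue_measure R]_(s in `[0%R, +oo[) (((1 + d * s) ^- 2)%:E * G (s / (1 + d * s))%R)
   = \int[@lebesgue_measure R]_(r in `[0%R, d^-1%R[) G r)%E.
Proof.
move=> d0 G0 mG.
(* The absolute value makes [phi] continuous on the whole line; the weight [w2] vanishes on negative
   [s]. *)
pose u (s : R) : R := 1 + d * `|s|.
have u0 s : 0 < u s by rewrite ltr_pwDl// mulr_ge0// ltW.
have cu : continuous u.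
  by move=> s; apply: cvgD; [exact: cvg_cst|apply: cvgM; [exact: cvg_cst|exact: norm_continuous]].
have cui : continuous (fun s => (u s)^-1).
  by move=> s; apply: cvgV; [rewrite gt_eqF|exact: cu].
pose phi (s : R) : R := `|s| / u s.
have mphi : measurable_fun setT phi.
  by apply: continuous_measurable_fun => s; apply: cvgM; [exact: norm_continuous|exact: cui].
have phi0 s : 0 <= phi s by rewrite divr_ge0// ltW.
have phid s : phi s < d^-1.
  by rewrite ltr_pdivrMr// /u mulrDr mulr1 mulKf ?gt_eqF// ltrDr invr_gt0.
pose I1 : set R := `[0, d^-1[%classic.
pose I2 : set R := `[0, +oo[%classic.
pose v (s : R) : R := u s ^- 2.
have v0 s : 0 <= v s by rewrite invr_ge0 exprn_ge0// ltW.
have cv : continuous v.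
  move=> s; rewrite (_ : v = (fun s => (u s)^-1 * (u s)^-1)).
    by apply: cvgM; exact: cui.
  by apply/funext => x; rewrite /v expr2 invfM.
have mI1 : measurable I1 by exact: measurable_itv.
have mI2 : measurable I2 by exact: measurable_itv.
pose psi (s : R) : R := d^-1 - (d * (1 + d * s))^-1.
have psi0 : psi 0 = 0 by rewrite /psi mulr0 addr0 mulr1 subrr.
have psiE s : 0 <= s -> psi s = phi s.
  move=> s0; rewrite /psi /phi /u ger0_norm//; field.
  by rewrite !gt_eqF// ltr_pwDl// mulr_ge0// ltW.
have psi' s : 0 < s -> psi^`()%classic s = v s.
  move=> s0; have [_] := psi_derive d0 s0.
  by rewrite derive1E /v /u gtr0_norm.
pose w2 (s : R) : R := v s * \1_I2 s.
pose w1 (s : R) : R := \1_I1 s.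
have w20 s : 0 <= w2 s by rewrite mulr_ge0// indicE.
have w10 s : 0 <= w1 s by rewrite /w1 indicE.
have mw2 : measurable_fun (setT : set (measurableTypeR R)) w2.
  by apply: measurable_funM; [exact: continuous_measurable_fun|exact: measurable_indic].
have mw1 : measurable_fun (setT : set (measurableTypeR R)) w1 by exact: measurable_indic.
have [m1 [m1E m1G]] : exists m : {measure set (measurableTypeR R) -> \bar R},
    (forall A, m A = \int[@lebesgue_measure R]_(t in A) (w1 t)%:E)%E /\
    (\int[m]_t G t = \int[@lebesgue_measure R]_t ((w1 t)%:E * G t))%E.
  unshelve refine (ex_intro _ (weighted_measure w1 : {measure set (measurableTypeR R) -> \bar R}) _) => //.
  by split => //; exact: ge0_integral_weighted.
have [m2 [m2E m2G]] : exists m : {measure set (measurableTypeR R) -> \bar R},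
    (forall A, m A = \int[@lebesgue_measure R]_(t in phi @^-1` A) (w2 t)%:E)%E /\
    (\int[m]_t G t = \int[@lebesgue_measure R]_t ((w2 t)%:E * G (phi t)))%E.
  unshelve refine (ex_intro _ (pushforward (weighted_measure w2) (phi : measurableTypeR R -> measurableTypeR R) : {measure set (measurableTypeR R) -> \bar R}) _) => //.
  split => //; rewrite (@ge0_integral_pushforward _ _ (measurableTypeR R) (measurableTypeR R))//.
  rewrite ge0_integral_weighted//.
    exact: (measurableT_comp mG).
  by move=> t; exact: G0.
have m12 (A : set (measurableTypeR R)) : measurable A -> m1 A = m2 A.
  apply: (@measure_unique _ _ (measurableTypeR R) (@RGenInftyO.G R) (fun k => `]-oo, k%:R[%classic)).
  - exact: RGenInftyO.measurableE.
  - move=> _ _ [x ->] [y ->]; exists (Num.min x y); apply/seteqP; split=> z /=.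
      by rewrite !in_itv/= lt_min => -[-> ->].
    by rewrite !in_itv/= lt_min => /andP[].
  - by move=> k; exists k%:R.
  - apply/seteqP; split=> // z _; exists (Num.bound `|z|) => //=.
    by rewrite in_itv/= (le_lt_trans (ler_norm _))// archi_boundP.
  - move=> _ [x ->]; rewrite m1E m2E.
    have -> : (\int[@lebesgue_measure R]_(t in `]-oo, x[) (w1 t)%:E =
        lebesgue_measure (I1 `&` `]-oo, x[ : set R))%E.
      by rewrite integral_indic//; exact: measurable_itv.
    have -> : (\int[@lebesgue_measure R]_(t in phi @^-1` `]-oo, x[) (w2 t)%:E =
        \int[@lebesgue_measure R]_(t in phi @^-1` `]-oo, x[ `&` I2) (v t)%:E)%E.
      rewrite integral_mkcondr; apply: eq_integral => t _; rewrite patchE /w2 indicE.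
      by case: (t \in I2); rewrite ?mulr1 ?mulr0.
    have FTC : forall b : R, 0 < b ->
        (\int[@lebesgue_measure R]_(t in `[0%R, b]) (v t)%:E = (phi b)%:E)%E.
      move=> b b0.
      rewrite (@continuous_FTC2 R v psi 0 b)//.
      + by rewrite psi0 sube0 psiE// ltW.
      + exact: continuous_subspaceT.
      + split.
        * by move=> t; rewrite in_itv/= => /andP[t0 _]; have [] := psi_derive d0 t0.
        * by apply: cvg_at_right_filter; exact: psi_cvg.
        * by apply: cvg_at_left_filter; apply: psi_cvg => //; exact: ltW.
      + by move=> t; rewrite in_itv/= => /andP[t0 _]; exact: psi'.
    have FTCy : (\int[@lebesgue_measure R]_(t in `[0%R, +oo[) (v t)%:E = (d^-1)%:E)%E.
      rewrite (@ge0_continuous_FTC2y R v psi 0 d^-1)//.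
      + by rewrite psi0 sube0.
      + exact: continuous_subspaceT.
      + exact: psi_cvgy.
      + by move=> t t0; have [] := psi_derive d0 t0.
      + by apply: cvg_at_right_filter; exact: psi_cvg.
      + by move=> t; rewrite in_itv/= andbT => t0; exact: psi'.
    have [x0|x0] := leP x 0.
      have -> : I1 `&` `]-oo, x[ = set0.
        by apply/seteqP; split=> // z; rewrite /I1/= !in_itv/= => -[/andP[h1 _] h2]; lra.
      have -> : phi @^-1` `]-oo, x[ `&` I2 = set0.
        apply/seteqP; split=> // z [] /=; rewrite !in_itv/=.
        by move=> h _; have := phi0 z; lra.
      by rewrite measure0 integral_set0.
    have [xd|xd] := ltP x d^-1; last first.
      have -> : I1 `&` `]-oo, x[ = I1.
        apply/seteqP; split=> [z []//|z h]; split => //.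
        by move: h; rewrite /I1/= !in_itv/= => /andP[_ h]; exact: lt_le_trans xd.
      have -> : phi @^-1` `]-oo, x[ `&` I2 = I2.
        apply/seteqP; split=> [z []//|z h]; split => //.
        by rewrite /= in_itv/= (lt_le_trans (phid z)).
      rewrite FTCy /I1 lebesgue_measure_itv/= lte_fin invr_gt0 d0.
      by rewrite -EFinB subr0.
    have dx : 0 < 1 - d * x by rewrite subr_gt0 mulrC -ltr_pdivlMr// mul1r.
    pose c := x / (1 - d * x); have c0 : 0 < c by rewrite divr_gt0.
    have -> : I1 `&` `]-oo, x[ = `[0, x[%classic.
      apply/seteqP; split=> z /=; rewrite /I1/= !in_itv/=.
        by move=> [/andP[-> _] ->].
      by move=> /andP[z0 zx]; rewrite z0 zx (lt_trans zx xd).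
    have -> : phi @^-1` `]-oo, x[ `&` I2 = `[0, c[%classic.
      have E z : 0 <= z -> (phi z < x) = (z < c).
        move=> z0; rewrite /phi /u ger0_norm// /c ltr_pdivlMr// ltr_pdivrMr; last first.
          by rewrite ltr_pwDl// mulr_ge0// ltW.
        by apply/idP/idP => h; lra.
      apply/seteqP; split=> z /=; rewrite /I2/= !in_itv/= andbT.
        by move=> [h z0]; rewrite z0 -E.
      by move=> /andP[z0 zc]; rewrite E.
    rewrite integral_itv_bndo_bndc; last first.
      by apply/measurable_funTS/measurable_EFinP; exact: continuous_measurable_fun.
    rewrite FTC// lebesgue_measure_itv/= lte_fin x0 -EFinB subr0; congr EFin.
    rewrite /phi /u gtr0_norm// /c; field.
    by rewrite gt_eqF//=; apply/eqP; lra.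
  - move=> k; rewrite m1E.
    have mk : measurable (`]-oo, k%:R[%classic : set R) by exact: measurable_itv.
    have -> : (\int[@lebesgue_measure R]_(t in `]-oo, k%:R[) (w1 t)%:E =
        lebesgue_measure (I1 `&` `]-oo, k%:R[ : set R))%E.
      by rewrite integral_indic.
    apply: (@le_lt_trans _ _ (lebesgue_measure I1)).
      apply: le_measure; rewrite ?inE//; first exact: measurableI.
    by rewrite /I1 lebesgue_measure_itv; case: ifP; rewrite /= ?ltry.
transitivity (\int[m2]_t G t)%E.
  rewrite m2G integral_mkcond; apply: eq_integral => t _; rewrite /w2 patchE indicE.
  case: ifPn => [|_]; last by rewrite mulr0 mul0e.
  rewrite mulr1.
  by rewrite inE /I2/= in_itv/= andbT => t0; rewrite /phi /v /u ger0_norm.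
transitivity (\int[m1]_t G t)%E.
  by apply: eq_measure_integral => A mA _; apply/esym/m12.
rewrite m1G [RHS]integral_mkcond; apply: eq_integral => t _; rewrite /w1 patchE indicE.
by case: ifPn => _; rewrite ?mul1e ?mul0e.
Qed.

(** * Radial integrals of a log-concave function *)

Definition log_concave1 (R : realType) (h : R -> R) : Prop :=
  (forall r, 0 <= h r) /\
  forall a b t, 0 <= t <= 1 -> h a `^ (1 - t) * h b `^ t <= h ((1 - t) * a + t * b).

Lemma log_concave_ray (R : realType) (n : nat) (f : 'rV[R]_n -> R) x :
  log_concave f -> log_concave1 (fun r => f (r *: x)).
Proof.
move=> [f0 lf]; split=> // a b t t01; have := lf (a *: x) (b *: x) t t01.
by rewrite !scalerA -scalerDl.
Qed.

Lemma log_concave1_ge_min (R : realType) (h : R -> R) a b z :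
  log_concave1 h -> a <= z <= b -> Num.min (h a) (h b) <= h z.
Proof.
move=> [h0 lh] /andP[az zb].
have [ab|ab] := ltP a b; last first.
  by have -> : z = a; [apply/le_anti; rewrite az andbT (le_trans zb)|rewrite ge_min lexx].
pose t := (z - a) / (b - a).
have ab0 : 0 < b - a by rewrite subr_gt0.
have t01 : 0 <= t <= 1.
  by rewrite divr_ge0 ?subr_ge0 ?(ltW ab)//= ler_pdivrMr// mul1r lerD2r.
have -> : z = (1 - t) * a + t * b by rewrite /t; field; rewrite gt_eqF.
apply: le_trans (lh _ _ _ t01); case/andP: t01 => t0 t1.
set m := Num.min _ _; have m0 : 0 <= m by rewrite le_min !h0.
have -> : m = m `^ (1 - t) * m `^ t.
  by rewrite -powRD ?subrK ?powRr1// oner_eq0.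
by apply: ler_pM; rewrite ?powR_ge0// ge0_ler_powR ?nnegrE ?subr_ge0// ge_min lexx ?orbT.
Qed.

Lemma measurable_log_concave1 (R : realType) (h : R -> R) :
  log_concave1 h -> measurable_fun setT h.
Proof.
move=> lh; apply: (measurability _ (RGenOInfty.measurableE R)).
move=> /= _ [_ [a ->]] <-; apply: measurableI => //.
apply: is_interval_measurable => x y /=; rewrite !in_itv/= !andbT => hx hy z xzy.
by rewrite in_itv/= andbT (lt_le_trans _ (log_concave1_ge_min lh xzy))// lt_min hx.
Qed.

Lemma measurable_expRM (R : realType) (k : R) (D : set R) :
  measurable_fun D (fun r : R => (expR (k * r))%:E).
Proof.
apply: measurable_funTS; apply/measurable_EFinP.
by apply: measurableT_comp => //; exact: mulrl_measurable.
Qed.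

Lemma integral_expRN (R : realType) (k : R) : 0 < k ->
  (\int[@lebesgue_measure R]_(r in `[0%R, +oo[) (expR (- k * r))%:E = (k^-1)%:E)%E.
Proof.
move=> k0; have := integral_exponential_pdf k0.
have -> : (\int[@lebesgue_measure R]_x (exponential_pdf k x)%:E =
    \int[@lebesgue_measure R]_(x in `[0%R, +oo[) (k%:E * (expR (- k * x))%:E))%E.
  rewrite [RHS]integral_mkcond; apply: eq_integral => x _.
  by rewrite /exponential_pdf !patchE; case: ifP.
rewrite ge0_integralZl//; last 2 first.
- exact: measurable_expRM.
- by rewrite lee_fin ltW.
move=> h; have := congr1 (fun z => (k^-1)%:E * z)%E h.
by rewrite muleA -EFinM mulVf ?gt_eqF// mul1e mule1.
Qed.

Lemma is_derive_exprn (R : realType) (n : nat) (x : R) :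
  is_derive x (1 : R) (fun r : R => r ^+ n) (n%:R * x ^+ n.-1).
Proof.
apply: DeriveDef; first exact: exprn_derivable.
by rewrite exp_derive /GRing.scale/= mulr1.
Qed.

Lemma integral_exprn (R : realType) (n : nat) (b : R) : (0 < n)%N -> 0 < b ->
  (\int[@lebesgue_measure R]_(r in `[0%R, b]) (r ^+ n.-1)%:E = (b ^+ n / n%:R)%:E)%E.
Proof.
move=> n0 b0; have nn0 : n%:R != 0 :> R by rewrite pnatr_eq0 -lt0n.
pose F (r : R) : R := n%:R^-1 * r ^+ n.
have cF : continuous F.
  by move=> x; apply: cvgM; [exact: cvg_cst|exact: exprn_continuous].
have DF (x : R) : is_derive x (1 : R) F (x ^+ n.-1).
  apply: (is_derive_eq (is_deriveZ n%:R^-1 (is_derive_exprn n x))).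
  by rewrite /GRing.scale/= mulrA mulVf// mul1r.
rewrite (@continuous_FTC2 R (fun r => r ^+ n.-1) F 0 b)//.
- by rewrite /F expr0n gtn_eqF// mulr0 sube0 mulrC.
- exact/continuous_subspaceT/exprn_continuous.
- split.
  + by move=> x _; have [] := DF x.
  + by apply: cvg_at_right_filter; exact: cF.
  + by apply: cvg_at_left_filter; exact: cF.
- by move=> x _; have [_] := DF x; rewrite derive1E.
Qed.

Section radial.
Context (R : realType) (n : nat) (h : R -> R).
Hypotheses (n0 : (0 < n)%N) (lh : log_concave1 h) (h00 : 0 < h 0).

Local Notation mu := (@lebesgue_measure R).
Let h0 : forall r, 0 <= h r. Proof. by case: lh. Qed.
Let mh : measurable_fun setT h. Proof. exact: measurable_log_concave1. Qed.

Local Notation J := (\int[mu]_(r in `[0%R, +oo[) (r ^+ n.-1 * h r)%:E)%E.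

Lemma measurable_radial m (D : set R) : measurable_fun D (fun r => (r ^+ m * h r)%:E).
Proof.
by apply: measurable_funTS; apply/measurable_EFinP; apply: measurable_funM.
Qed.

(** [rho] lies between 0 and [s], so log-concavity bounds [h rho] below by a geometric mean of [h 0]
    and [h s]; this is solved for [h s]. *)
Lemma log_concave1_decay rho a s : 0 < rho -> h rho <= h 0 * expR (- a) ->
  rho <= s -> h s <= h 0 * expR (- a * (s / rho)).
Proof.
move=> r0 hr rs; have s0 : 0 < s by exact: lt_le_trans rs.
have := h0 s; rewrite le_eqVlt => /predU1P[<-|hs].
  by rewrite mulr_ge0 ?expR_ge0.
pose t := rho / s; have t0 : 0 < t by rewrite divr_gt0.
have t01 : 0 <= t <= 1 by rewrite ltW//= ler_pdivrMr// mul1r.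
have := proj2 lh 0 s t t01; rewrite mulr0 add0r divfK ?gt_eqF// => ht.
have v0 : 0 < h 0 `^ (1 - t) * h s `^ t by rewrite mulr_gt0// powR_gt0.
have hE : 0 < h 0 * expR (- a) by rewrite mulr_gt0 ?expR_gt0.
have : ln (h 0 `^ (1 - t) * h s `^ t) <= ln (h 0 * expR (- a)).
  by rewrite ler_ln ?posrE// (le_trans ht).
rewrite !lnM ?posrE ?powR_gt0 ?expR_gt0// !ln_powR expRK => hln.
have : t * (ln (h s) - ln (h 0)) <= - a by lra.
rewrite mulrC -ler_pdivlMr// => hln2.
rewrite -(lnK (x := h s)) ?posrE// -{1}(lnK (x := h 0)) ?posrE// -expRD ler_expR.
have -> : - a * (s / rho) = - a / t by rewrite /t invf_div mulrA.
lra.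
Qed.

Lemma radial_lower b : 0 < b ->
  ((Num.min (h 0) (h b) * (b ^+ n / n%:R))%:E <= J)%E.
Proof.
move=> b0; rewrite EFinM -integral_exprn// -ge0_integralZl//; last 3 first.
- by apply: measurable_funTS; apply/measurable_EFinP; exact: measurable_funX.
- by move=> r; rewrite /= in_itv/= => /andP[r0 _]; rewrite lee_fin exprn_ge0.
- by rewrite lee_fin le_min !h0.
apply: (@le_trans _ _ (\int[mu]_(r in `[0%R, b]) (r ^+ n.-1 * h r)%:E)%E).
  apply: ge0_le_integral => //.
  - move=> r; rewrite /= in_itv/= => /andP[r0 _].
    by rewrite mule_ge0// lee_fin ?le_min ?h0// exprn_ge0.
  - by apply: measurable_funTS; apply/measurable_EFinP; apply: measurable_funM.
  - exact: measurable_radial.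
  - move=> r; rewrite /= in_itv/= => rb; have /andP[r0 _] := rb.
    by rewrite -EFinM lee_fin mulrC ler_wpM2l ?exprn_ge0// log_concave1_ge_min.
apply: ge0_subset_integral => //.
- exact: measurable_radial.
- by move=> r; rewrite /= in_itv/= andbT => r0; rewrite lee_fin mulr_ge0// exprn_ge0.
- by move=> r; rewrite /= !in_itv/= => /andP[->].
Qed.

(** Up to [rho] the integrand is bounded through [C]; beyond it, [r ^+ n.-1] is at most [c ^- n.-1]
    times [e^(n c r)], and the decay of [h] absorbs this exponential. The rate [c] is left free for
    the two uses. *)
Lemma radial_upper C rho a c : 0 < rho -> 0 < c -> n%:R * c < a / rho ->
  (forall r, h r <= C) -> h rho <= h 0 * expR (- a) ->
  (J <= (C * (rho ^+ n / n%:R) + h 0 * c ^- n.-1 / (a / rho - n%:R * c))%:E)%E.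
Proof.
move=> r0 c0 ca hC hr; set k := a / rho - n%:R * c.
have k0 : 0 < k by rewrite subr_gt0.
have C0 : 0 <= C by exact: le_trans (hC 0).
pose I : set R := `[0, rho]%classic.
have mI : measurable I by exact: measurable_itv.
pose U (r : R) : R := C * (r ^+ n.-1 * \1_I r).
pose V (r : R) : R := h 0 * c ^- n.-1 * expR (- k * r).
have V0 r : 0 <= V r by rewrite mulr_ge0 ?expR_ge0// mulr_ge0 ?invr_ge0 ?exprn_ge0// ltW.
have U0 r : 0 <= r -> 0 <= U r.
  by move=> ?; rewrite mulr_ge0// mulr_ge0 ?exprn_ge0// indicE.
have mUr : measurable_fun (`[0%R, +oo[%classic : set R) (fun r : R => (r ^+ n.-1 * \1_I r)%:E).
  apply: measurable_funTS; apply/measurable_EFinP; apply: measurable_funM; last exact: measurable_indic.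
  exact: measurable_funX.
have mU : measurable_fun (`[0%R, +oo[%classic : set R) (EFin \o U).
  have := @emeasurable_funM _ _ _ _ (cst C%:E) _ (@measurable_cst _ _ _ _ _ C%:E) mUr.
  by apply: eq_measurable_fun => r _.
have mE : measurable_fun (`[0%R, +oo[%classic : set R) (fun r : R => (expR (- k * r))%:E).
  exact: measurable_expRM.
have mV : measurable_fun (`[0%R, +oo[%classic : set R) (EFin \o V).
  have := @emeasurable_funM _ _ _ _ (cst (h 0 * c ^- n.-1)%:E) _ (@measurable_cst _ _ _ _ _ (h 0 * c ^- n.-1)%:E) mE.
  by apply: eq_measurable_fun => r _.
apply: (@le_trans _ _ (\int[mu]_(r in `[0%R, +oo[) ((U r)%:E + (V r)%:E))%E).
  apply: ge0_le_integral => //.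
  - by move=> r; rewrite /= in_itv/= andbT => ?; rewrite lee_fin mulr_ge0// exprn_ge0.
  - exact: measurable_radial.
  - exact: emeasurable_funD.
  move=> r; rewrite /= in_itv/= andbT => rge0; rewrite -EFinD lee_fin.
  have [rr|rr] := leP r rho.
    apply: (@le_trans _ _ (U r)); last by rewrite lerDl.
    rewrite /U indicE mem_set/= ?mulr1; last by rewrite /I/= in_itv/= rge0.
    by rewrite mulrC ler_wpM2r// exprn_ge0.
  apply: (@le_trans _ _ (V r)); last by rewrite lerDr U0.
  have hd := log_concave1_decay r0 hr (ltW rr).
  apply: le_trans (ler_wpM2l _ hd) _; first exact: exprn_ge0.
  have re : r ^+ n.-1 <= c ^- n.-1 * expR (n%:R * c * r).
    rewrite -ler_pdivrMl ?invr_gt0 ?exprn_gt0// invrK -exprMn.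
    apply: (@le_trans _ _ (expR (c * r) ^+ n.-1)).
      rewrite lerXn2r ?nnegrE ?expR_ge0 ?mulr_ge0 ?(ltW c0)//.
      by apply: le_trans (expR_ge1Dx _); rewrite lerDr.
    rewrite -expRM_natl ler_expR -mulrA ler_wpM2r ?mulr_ge0 ?(ltW c0)//.
    by rewrite ler_nat leq_pred.
  apply: le_trans (ler_wpM2r _ re) _; first by rewrite mulr_ge0 ?expR_ge0// ltW.
  rewrite /V le_eqVlt; apply/orP; left; apply/eqP.
  have -> : - k * r = n%:R * c * r + - a * (r / rho) by rewrite /k; field; rewrite gt_eqF.
  by rewrite expRD; ring.
rewrite ge0_integralD//; last 2 first.
- by move=> r; rewrite /= in_itv/= andbT => ?; rewrite lee_fin U0.
- by move=> r _; rewrite lee_fin.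
have IU : (\int[mu]_(r in `[0%R, +oo[) (r ^+ n.-1 * \1_I r)%:E = (rho ^+ n / n%:R)%:E)%E.
  rewrite -integral_exprn// integral_mkcond [RHS]integral_mkcond.
  apply: eq_integral => r _; rewrite !patchE indicE -/I.
  have [rI|rI] := boolP (r \in I); last by rewrite mulr0 if_same.
  rewrite mulr1; move: rI; rewrite inE /I/= in_itv/= => /andP[rr _].
  by rewrite mem_set//= in_itv/= rr.
rewrite EFinD leeD//.
  under eq_integral do rewrite EFinM.
  rewrite ge0_integralZl ?lee_fin//; last first.
    by move=> r; rewrite /= in_itv/= andbT => ?; rewrite lee_fin mulr_ge0 ?exprn_ge0// indicE.
  by rewrite IU -EFinM.
under eq_integral do rewrite EFinM.
rewrite ge0_integralZl//.
- by rewrite integral_expRN// -EFinM.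
- by rewrite lee_fin mulr_ge0 ?invr_ge0 ?exprn_ge0// ltW.
Qed.

Lemma radial_fin C rho : (forall r, h r <= C) -> 0 < rho -> h rho < h 0 ->
  (J < +oo)%E.
Proof.
move=> hC r0 hr.
have [a a0 ha] : exists2 a, 0 < a & h rho <= h 0 * expR (- a).
  have := h0 rho; rewrite le_eqVlt => /predU1P[<-|hr0].
    by exists 1 => //; rewrite mulr_ge0 ?expR_ge0// ltW.
  exists (ln (h 0) - ln (h rho)); first by rewrite subr_gt0 ltr_ln ?posrE.
  by rewrite opprB expRD expRN !lnK ?posrE// mulrC divfK// gt_eqF.
have nn : 0 < n%:R :> R by rewrite ltr0n.
pose c := a / (2 * n%:R * rho).
have c0 : 0 < c by rewrite divr_gt0// !mulr_gt0.
apply: le_lt_trans (radial_upper r0 c0 _ hC ha) (ltry _).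
have -> : n%:R * c = (a / rho) / 2 by rewrite /c; field; rewrite !gt_eqF.
have : 0 < a / rho by rewrite divr_gt0.
lra.
Qed.

(** By contraposition: taking [a = 2 n] and [c = rho^-1] in [radial_upper] bounds [n] times the
    integral by [(M^n + 1) rho^n h 0], and the 3 makes [(3 M)^n] exceed [M^n + 1]. *)
Lemma radial_level M rho : 1 <= M -> (forall r, h r <= M ^+ n * h 0) -> 0 < rho ->
  (((3 * M * rho) ^+ n * h 0)%:E <= n%:R%:E * J)%E -> h 0 * expR (- (2 * n%:R)) <= h rho.
Proof.
move=> M1 hM r0; apply: contraTT; rewrite -!ltNge => /ltW hr.
have nn : 0 < n%:R :> R by rewrite ltr0n.
have c0 : 0 < rho^-1 by rewrite invr_gt0.
have ca : n%:R * rho^-1 < (2 * n%:R) / rho by rewrite ltr_pM2r//; lra.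
have := radial_upper r0 c0 ca hM hr.
set X := (_ + _)%R => JX.
have : (n%:R%:E * J <= (n%:R * X)%:E)%E by rewrite EFinM lee_pmul2l.
move/le_lt_trans; apply; rewrite lte_fin.
have -> : n%:R * X = (M ^+ n + 1) * rho ^+ n * h 0.
  have rE : rho ^+ n = rho * rho ^+ n.-1 by rewrite -exprS prednK.
  have -> : X = M ^+ n * h 0 * (rho ^+ n / n%:R) + h 0 * rho ^+ n.-1 / (n%:R / rho).
    rewrite /X exprVn invrK; congr (_ + _ / _).
    by field; rewrite gt_eqF.
  by rewrite rE; field; rewrite !gt_eqF.
rewrite !exprMn ltr_pM2r// ltr_pM2r ?exprn_gt0//.
have M1n : 1 <= M ^+ n by rewrite exprn_ege1.
have : 3 * M ^+ n <= 3 ^+ n * M ^+ n.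
  by rewrite ler_wpM2r ?(le_trans ler01)// ler_eXnr// ler1n.
lra.
Qed.

(** At [b = e^4 s] the lower bound on the integral forces [h b <= h 0 e^(-4n)]. The part [r <= 2 b]
    contributes at most [2 b Jr] and the tail at most [b Jr]. *)
Lemma radial_moment Jr s : J = Jr%:E -> 0 < s -> s ^+ n * h 0 = n%:R * Jr ->
  (\int[mu]_(r in `[0%R, +oo[) (r ^+ n * h r)%:E <= (3 * expR 4 * s * Jr)%:E)%E.
Proof.
move=> JE s0 sE; pose b := expR 4 * s.
have b0 : 0 < b by rewrite mulr_gt0 ?expR_gt0.
have nn : 0 < n%:R :> R by rewrite ltr0n.
have hb : h b <= h 0 * expR (- (4 * n%:R)).
  have := radial_lower b0; rewrite JE lee_fin mulrA ler_pdivrMr// [Jr * _]mulrC -sE.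
  rewrite /b exprMn -expRM_natl => hl.
  have {}hl : Num.min (h 0) (h b) * expR (n%:R * 4) <= h 0.
    by rewrite -(ler_pM2r (exprn_gt0 n s0)) -mulrA [leRHS]mulrC.
  have e1 : 1 < expR (n%:R * 4) :> R by rewrite expR_gt1 mulr_gt0.
  have [hh|hh] := leP (h 0) (h b).
    move: hl; rewrite min_l// => hl.
    by have : h 0 * 1 < h 0 * expR (n%:R * 4); [rewrite ltr_pM2l|lra].
  move: hl; rewrite min_r ?(ltW hh)// => hl.
  by rewrite expRN -ler_pdivrMr ?invr_gt0 ?expR_gt0// invrK mulrC [4 * _]mulrC mulrC.
have Jr0 : 0 < Jr.
  by rewrite -(pmulr_rgt0 _ nn) -sE mulr_gt0// exprn_gt0.
have mE : measurable_fun (`[0%R, +oo[%classic : set R) (fun r : R => (expR (- (n%:R / b) * r))%:E).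
  exact: measurable_expRM.
apply: (@le_trans _ _ (\int[mu]_(r in `[0%R, +oo[)
  ((2 * b)%:E * (r ^+ n.-1 * h r)%:E + (n%:R * Jr)%:E * (expR (- (n%:R / b) * r))%:E))%E).
  apply: ge0_le_integral => //.
  - by move=> r; rewrite /= in_itv/= andbT => ?; rewrite lee_fin mulr_ge0// exprn_ge0.
  - exact: measurable_radial.
  - apply: emeasurable_funD; apply: emeasurable_funM => //; exact: measurable_radial.
  move=> r; rewrite /= in_itv/= andbT => r0.
  rewrite -!EFinM -EFinD lee_fin -{1}(prednK n0) exprS -mulrA.
  have x0 : 0 <= r ^+ n.-1 * h r by rewrite mulr_ge0// exprn_ge0.
  have [rb|rb] := leP r (2 * b).
    apply: (@le_trans _ _ (2 * b * (r ^+ n.-1 * h r))); first by rewrite ler_wpM2r.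
    by rewrite lerDl mulr_ge0 ?expR_ge0// mulr_ge0// ltW.
  apply: (@le_trans _ _ (n%:R * Jr * expR (- (n%:R / b) * r))); last first.
    by rewrite lerDr mulr_ge0// mulr_ge0// ltW.
  rewrite mulrA -exprS prednK//.
  have br : b <= r by lra.
  have hd := log_concave1_decay b0 hb br.
  apply: le_trans (ler_wpM2l _ hd) _; first exact: exprn_ge0.
  (* The exponents add up to [4 n + n v - 4 n v], at most [- n v] as soon as [v >= 2]; this is why
     the cut is at [2 * b]. *)
  pose v := r / b; have rE : r = b * v by rewrite /v mulrC divfK// gt_eqF.
  have v2 : 2 <= v by rewrite ler_pdivlMr// ltW.
  rewrite -sE -/v {1}rE exprMn /b exprMn -expRM_natl.
  have -> : - (n%:R / (expR 4 * s)) * r = - (n%:R * v) by rewrite /v /b; ring.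
  have vn : v ^+ n <= expR (n%:R * v).
    rewrite expRM_natl lerXn2r ?nnegrE ?expR_ge0//; first lra.
    by apply: le_trans (expR_ge1Dx _); rewrite lerDr.
  have -> : expR (n%:R * 4) * s ^+ n * v ^+ n * (h 0 * expR (- (4 * n%:R) * v)) =
     s ^+ n * h 0 * (v ^+ n * expR (n%:R * 4 + - (4 * n%:R) * v)) by rewrite expRD; ring.
  rewrite ler_wpM2l ?mulr_ge0 ?exprn_ge0 ?(ltW s0)//.
  apply: le_trans (ler_wpM2r (expR_ge0 _) vn) _.
  rewrite -expRD ler_expR.
  have : 0 <= n%:R * (v - 2) by rewrite mulr_ge0// subr_ge0.
  lra.
rewrite ge0_integralD//; last 4 first.
- by move=> r; rewrite /= in_itv/= andbT => ?; rewrite -EFinM lee_fin !mulr_ge0// ?exprn_ge0// ltW.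
- by apply: emeasurable_funM => //; exact: measurable_radial.
- by move=> r _; rewrite -EFinM lee_fin !mulr_ge0// ?expR_ge0// ltW.
- exact: emeasurable_funM.
rewrite !ge0_integralZl//; last 4 first.
- by rewrite lee_fin mulr_ge0// ltW.
- exact: measurable_radial.
- by move=> r; rewrite /= in_itv/= andbT => ?; rewrite lee_fin mulr_ge0// exprn_ge0.
- by rewrite lee_fin mulr_ge0// ltW.
rewrite JE integral_expRN ?divr_gt0// -!EFinM -EFinD lee_fin invf_div.
rewrite le_eqVlt; apply/orP; left; apply/eqP; rewrite /b; field.
by rewrite gt_eqF.
Qed.

End radial.

(** * The radial map *)

(** The Jacobian contributes [(1 + d s)^-2] and the weight [(1 + d s)^-(n-1)]; their product is at
    least [e^(-(n+1) d s)]. The set [D] will be [[0, 1]] for the numerator of [u ^ n] and the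
    half-line for its denominator. *)
Lemma radial_harmonic (R : realType) (n : nat) (hx hy : R -> R) (d k : R) (D : set R) :
  (0 < n)%N -> log_concave1 hx -> log_concave1 hy -> 0 < d ->
  (forall s, 0 <= s -> hy s * expR (- (k * d) * s) <= hx (s / (1 + d * s))) ->
  measurable D -> (forall s, D s -> 0 <= s /\ D (s / (1 + d * s))) ->
  (\int[@lebesgue_measure R]_(s in D) (s ^+ n.-1 * hy s * expR (- ((k + n.+1%:R) * d) * s))%:E <=
   \int[@lebesgue_measure R]_(r in D) (r ^+ n.-1 * hx r)%:E)%E.
Proof.
move=> n0 lhx lhy d0 hxy mD DD; have [hx0 _] := lhx; have [hy0 _] := lhy.
pose G : R -> \bar R := (fun r : R => (r ^+ n.-1 * hx r)%:E) \_ D.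
have G0 t : (0 <= G t)%E.
  rewrite /G patchE; case: ifPn => // /set_mem /DD[t0 _].
  by rewrite lee_fin mulr_ge0// exprn_ge0.
have mG : measurable_fun setT G.
  rewrite /G; apply/(measurable_restrictT _ mD).
  exact: (@measurable_radial R hx lhx n.-1 D).
rewrite [leRHS]integral_mkcond -/G.
apply: (@le_trans _ _ (\int[@lebesgue_measure R]_(r in `[0%R, d^-1%R[) G r)%E); last first.
  by apply: ge0_subset_integral => //; exact: measurable_itv.
rewrite -harmonic_substitution// [leLHS]integral_mkcond [leRHS]integral_mkcond.
apply: ge0_le_integralT => s; rewrite !patchE.
  case: ifPn => // /set_mem /DD[s0 _].
  by rewrite lee_fin mulr_ge0 ?expR_ge0// mulr_ge0// exprn_ge0.
case: ifPn => [/set_mem Ds|_]; last first.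
  by case: ifP => // _; rewrite mule_ge0// lee_fin invr_ge0 exprn_even_ge0.
have [s0 Dp] := DD s Ds.
rewrite mem_set; last by rewrite /= in_itv/= andbT.
rewrite /G patchE mem_set// -EFinM lee_fin.
set v := 1 + d * s; have ds0 : 0 <= d * s by rewrite mulr_ge0// ltW.
have v0 : 0 < v by rewrite /v; lra.
have h1 := hxy s s0; rewrite -/v in h1.
have h2 : expR (- (n.+1%:R * d) * s) <= v ^- n.+1.
  have -> : - (n.+1%:R * d) * s = - (n.+1%:R * (d * s)) by ring.
  rewrite expRN expRM_natl lef_pV2 ?posrE ?exprn_gt0 ?expR_gt0//.
  by rewrite lerXn2r ?nnegrE ?expR_ge0 ?(ltW v0)//; exact: expR_ge1Dx.
have -> : v ^- 2 * ((s / v) ^+ n.-1 * hx (s / v)) = s ^+ n.-1 * (hx (s / v) * v ^- n.+1).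
  have -> : v ^- n.+1 = v ^- 2 * v ^- n.-1 by rewrite -invfM -exprD add2n prednK.
  by rewrite exprMn exprVn; ring.
rewrite -mulrA ler_wpM2l ?exprn_ge0//.
have -> : - ((k + n.+1%:R) * d) * s = - (k * d) * s + - (n.+1%:R * d) * s by ring.
by rewrite expRD mulrA ler_pM ?mulr_ge0 ?expR_ge0.
Qed.

(* Jensen: [expR] lies above its tangent at the mean. *)
Lemma radial_tilt (R : realType) (n : nat) (h : R -> R) (K m Jr : R) :
  (0 < n)%N -> log_concave1 h -> 0 <= K -> 0 <= m ->
  (\int[@lebesgue_measure R]_(r in `[0%R, +oo[) (r ^+ n.-1 * h r)%:E = Jr%:E)%E ->
  (\int[@lebesgue_measure R]_(r in `[0%R, +oo[) (r ^+ n * h r)%:E <= (m * Jr)%:E)%E ->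
  ((expR (- (K * m)) * Jr)%:E <=
   \int[@lebesgue_measure R]_(r in `[0%R, +oo[) (r ^+ n.-1 * h r * expR (- K * r))%:E)%E.
Proof.
move=> n0 lh K0 m0 JE Jm; have [h0 _] := lh.
pose e := expR (- (K * m)); have e0 : 0 <= e by exact: expR_ge0.
have mT : measurable_fun (`[0%R, +oo[%classic : set R)
    (fun r : R => (r ^+ n.-1 * h r * expR (- K * r))%:E).
  have := emeasurable_funM (@measurable_radial R h lh n.-1 `[0%R, +oo[%classic)
    (@measurable_expRM R (- K) `[0%R, +oo[%classic).
  by apply: eq_measurable_fun => r _; rewrite EFinM.
have T0 (r : R) : `[0%R, +oo[%classic r -> (0 <= (r ^+ n.-1 * h r * expR (- K * r))%:E)%E.
  by rewrite /= in_itv/= andbT => r0; rewrite lee_fin mulr_ge0 ?expR_ge0// mulr_ge0// exprn_ge0.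
have S0 j (r : R) : `[0%R, +oo[%classic r -> (0 <= (r ^+ j * h r)%:E)%E.
  by rewrite /= in_itv/= andbT => r0; rewrite lee_fin mulr_ge0// exprn_ge0.
have mS j := @measurable_radial R h lh j `[0%R, +oo[%classic.
(* The negative term of the tangent stands on the right, so that both integrands are nonnegative. *)
have : (\int[@lebesgue_measure R]_(r in `[0%R, +oo[) ((e * (1 + K * m))%:E * (r ^+ n.-1 * h r)%:E) <=
  \int[@lebesgue_measure R]_(r in `[0%R, +oo[) ((r ^+ n.-1 * h r * expR (- K * r))%:E +
     (e * K)%:E * (r ^+ n * h r)%:E))%E.
  apply: ge0_le_integral => //.
  - by move=> r hr; rewrite mule_ge0 ?S0// lee_fin mulr_ge0// addr_ge0// mulr_ge0.
  - by apply: emeasurable_funM => //; exact: mS.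
  - apply: emeasurable_funD => //; apply: emeasurable_funM => //; exact: mS.
  move=> r; rewrite /= in_itv/= andbT => r0.
  rewrite -!EFinM -EFinD lee_fin -{3}(prednK n0) exprS.
  have x0 : 0 <= r ^+ n.-1 * h r by rewrite mulr_ge0// exprn_ge0.
  have h1 : e * (1 + K * m - K * r) <= expR (- K * r).
    have -> : expR (- K * r) = e * expR (K * m - K * r).
      by rewrite /e -expRD; congr expR; ring.
    by rewrite ler_wpM2l//; apply: le_trans (expR_ge1Dx _); rewrite addrA.
  have := ler_wpM2l x0 h1; set X := r ^+ n.-1 * h r.
  have -> : r * r ^+ n.-1 * h r = r * X by rewrite /X mulrA.
  lra.
have c1 : (0 <= (e * (1 + K * m))%:E)%E by rewrite lee_fin mulr_ge0// addr_ge0// mulr_ge0.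
have c2 : (0 <= (e * K)%:E)%E by rewrite lee_fin mulr_ge0.
have E1 : (\int[@lebesgue_measure R]_(r in `[0%R, +oo[) ((e * (1 + K * m))%:E * (r ^+ n.-1 * h r)%:E) =
    (e * (1 + K * m))%:E * \int[@lebesgue_measure R]_(r in `[0%R, +oo[) (r ^+ n.-1 * h r)%:E)%E.
  exact: (ge0_integralZl lebesgue_measure (measurable_itv _) (mS n.-1) (S0 n.-1) c1).
have E2 : (\int[@lebesgue_measure R]_(r in `[0%R, +oo[) ((e * K)%:E * (r ^+ n * h r)%:E) =
    (e * K)%:E * \int[@lebesgue_measure R]_(r in `[0%R, +oo[) (r ^+ n * h r)%:E)%E.
  exact: (ge0_integralZl lebesgue_measure (measurable_itv _) (mS n) (S0 n) c2).
rewrite E1.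
rewrite ge0_integralD//; last 2 first.
- by move=> r hr; rewrite mule_ge0 ?S0// lee_fin mulr_ge0.
- by apply: emeasurable_funM => //; exact: mS.
rewrite E2.
rewrite JE -EFinM => h1.
have h2 : ((e * K)%:E * \int[@lebesgue_measure R]_(r in `[0%R, +oo[) (r ^+ n * h r)%:E <=
    (e * K * (m * Jr))%:E)%E.
  by rewrite [leRHS]EFinM lee_wpmul2l.
have := le_trans h1 (leeD2l _ h2).
rewrite -leeBlDr// -EFinB; apply: le_trans; rewrite lee_fin /e; lra.
Qed.

Lemma expR_le1D2x (R : realType) (t : R) : 0 <= t <= 2^-1 -> expR t <= 1 + 2 * t.
Proof.
move=> /andP[t0 t1]; have := expR_ge1Dx (- t); rewrite expRN => h.
have p1 : 0 < 1 + - t by lra.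
have h1 : expR t <= (1 + - t)^-1 by rewrite -[leLHS]invrK lef_pV2 ?posrE ?invr_gt0 ?expR_gt0.
apply: le_trans h1 _; rewrite -[leLHS]mul1r ler_pdivrMr//.
have : 0 <= t * (1 - 2 * t) by rewrite mulr_ge0// subr_ge0; lra.
lra.
Qed.

(** The exponent grows with [m], but the increment carries a factor [v], and [v * m] is bounded. *)
Lemma increment_exp (R : realType) (v w m d k c M : R) :
  0 < d -> 0 < k -> 0 <= c -> 0 <= v <= 1 -> 0 <= m -> m * v <= M ->
  k * d * (1 + c * m) <= 2^-1 -> w <= v * expR (k * d * (1 + c * m)) ->
  w - v <= 2 * k * (1 + c * M) * d.
Proof.
move=> d0 k0 c0 /andP[v0 v1] m0 mv eta hw.
have kd0 : 0 <= k * d by rewrite mulr_ge0// ltW.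
have h : expR (k * d * (1 + c * m)) <= 1 + 2 * (k * d * (1 + c * m)).
  by rewrite expR_le1D2x// eta mulr_ge0// addr_ge0// mulr_ge0.
have {}h := le_trans hw (ler_wpM2l v0 h).
have h1 : k * d * v <= k * d by rewrite ler_piMr.
have h2 : k * d * c * (m * v) <= k * d * c * M by rewrite ler_wpM2l// mulr_ge0.
lra.
Qed.

Lemma invr_ge1_itv (R : realType) (a : R) : 1 <= a -> 0 < a^-1 <= 1.
Proof.
move=> a1; have a0 : 0 < a by exact: lt_le_trans a1.
by rewrite invr_gt0 a0 invf_le1.
Qed.

Lemma lt_quarter (R : realType) (a b : R) : 2^-1 < a + b -> a <= 4^-1 -> 4^-1 < b.
Proof. lra. Qed.

Lemma le_sum4 (R : realType) (w a b c d : R) : 0 <= a -> 0 <= b -> 0 <= c -> 0 <= d ->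
  [\/ w <= a, w <= b, w <= c | w <= d] -> w <= a + b + c + d.
Proof. move=> a0 b0 c0 d0; case; lra. Qed.

(** One summand per case of [u_radial_increment]: small exponent, [d] bounded below, [nu y] large,
    and [y = 0]. *)
Definition increment_const (R : realType) (kap : R) : R :=
  let k := 4 + kap in let M := expR kap in
  2 * k * (1 + 3 * expR 4 * M) + 4 * k + 2 * M * expR 2 * (36 * expR 4 * k * M) + 2 * M * expR 2.

Lemma increment_const_gt0 (R : realType) (kap : R) : 0 <= kap -> 0 < increment_const kap.
Proof.
move=> kap0; have : 0 < 4 + kap by rewrite ltr_pwDl.
rewrite /increment_const; move: (4 + kap) => k k0.
by rewrite !(addr_gt0, mulr_gt0) ?expR_gt0.
Qed.

Section radial_map.
Context (R : realType) (n : nat) (f : 'rV[R]_n -> R) (kap : R).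
Hypotheses (n0 : (0 < n)%N) (lcf : log_concave f) (f00 : 0 < f 0) (kap0 : 0 <= kap)
  (fM : forall x, f x <= expR kap ^+ n * f 0)
  (fpos : forall x, exists2 r, 0 < r & 0 < f (r *: x))
  (fdecay : forall x, x != 0 -> exists2 r, 0 < r & f (r *: x) < f 0).

Let f0 : forall x, 0 <= f x. Proof. by case: lcf. Qed.
Let M := expR kap.
Let M1 : 1 <= M. Proof. by rewrite -expR0 ler_expR. Qed.
Let nn : 0 < n%:R :> R. Proof. by rewrite ltr0n. Qed.
Let h0E (x : 'rV[R]_n) : f (0 *: x) = f 0. Proof. by rewrite scale0r. Qed.
Let h00 (x : 'rV[R]_n) : 0 < f (0 *: x). Proof. by rewrite scale0r. Qed.
Let lh (x : 'rV[R]_n) := log_concave_ray x lcf.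

Let A x := fine (radial_int f x `[0, 1]).
Let B x := fine (radial_int f x `[0, +oo[).

Lemma radial_int_ge0 x (D : set R) : (forall r, D r -> 0 <= r) -> (0 <= radial_int f x D)%E.
Proof.
move=> D0; apply: integral_ge0 => r /D0 r0.
by rewrite lee_fin mulr_ge0// exprn_ge0.
Qed.

Lemma radial_intBE x : x != 0 -> radial_int f x `[0, +oo[ = (B x)%:E.
Proof.
move=> x0; rewrite /B fineK// ge0_fin_numE; last first.
  by apply: radial_int_ge0 => r; rewrite /= in_itv/= andbT.
have [r r0 fr] := fdecay x0.
apply: (@radial_fin _ _ (fun r => f (r *: x)) n0 (lh x) (h00 x) (M ^+ n * f 0) r) => //.
by rewrite h0E.
Qed.

Lemma radial_int_le x : (radial_int f x `[0%R, 1%R] <= radial_int f x `[0%R, +oo[)%E.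
Proof.
apply: ge0_subset_integral => //.
- exact: (measurable_radial (lh x)).
- by move=> r; rewrite /= in_itv/= andbT => r0; rewrite lee_fin mulr_ge0// exprn_ge0.
- by move=> r; rewrite /= !in_itv/= => /andP[->].
Qed.

Lemma radial_intAE x : x != 0 -> radial_int f x `[0, 1] = (A x)%:E.
Proof.
move=> x0; rewrite /A fineK// ge0_fin_numE; last first.
  by apply: radial_int_ge0 => r; rewrite /= in_itv/= => /andP[].
by apply: le_lt_trans (radial_int_le x) _; rewrite radial_intBE// ltry.
Qed.

Lemma radialA_ge0 x : 0 <= A x.
Proof. by rewrite fine_ge0// radial_int_ge0// => r; rewrite /= in_itv/= => /andP[]. Qed.

Lemma radialB_lower x b : x != 0 -> 0 < b ->
  Num.min (f 0) (f (b *: x)) * b ^+ n <= n%:R * B x.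
Proof.
move=> x0 b0; have := @radial_lower _ _ (fun r => f (r *: x)) n0 (lh x) b b0.
rewrite -/(radial_int f x `[0%R, +oo[) radial_intBE// lee_fin h0E.
by rewrite mulrA ler_pdivrMr// [B x * _]mulrC.
Qed.

Lemma radialB_gt0 x : x != 0 -> 0 < B x.
Proof.
move=> x0; have [r r0 fr] := fpos x; rewrite -(pmulr_rgt0 _ nn).
by apply: lt_le_trans (radialB_lower x0 r0); rewrite mulr_gt0 ?exprn_gt0// lt_min f00.
Qed.

Lemma radialA_le x : x != 0 -> n%:R * A x <= M ^+ n * f 0.
Proof.
move=> x0; rewrite mulrC -ler_pdivlMr//.
have := radial_intAE x0; rewrite /radial_int => AE; rewrite -lee_fin -AE.
have -> : M ^+ n * f 0 / n%:R = M ^+ n * f 0 * (1 ^+ n / n%:R) by rewrite expr1n mul1r.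
rewrite EFinM -integral_exprn// -ge0_integralZl//; last 3 first.
- by apply: measurable_funTS; apply/measurable_EFinP; exact: measurable_funX.
- by move=> r; rewrite /= in_itv/= => /andP[r0 _]; rewrite lee_fin exprn_ge0.
- by rewrite lee_fin mulr_ge0// exprn_ge0// expR_ge0.
apply: ge0_le_integral => //.
- by move=> r; rewrite /= in_itv/= => /andP[r0 _]; rewrite lee_fin mulr_ge0// exprn_ge0.
- exact: (measurable_radial (lh x)).
- by apply: emeasurable_funM => //; apply: measurable_funTS; apply/measurable_EFinP; exact: measurable_funX.
- move=> r; rewrite /= in_itv/= => /andP[r0 _].
  by rewrite -EFinM lee_fin mulrC ler_wpM2r ?exprn_ge0.
Qed.

Lemma u_radial_ge0 x : 0 <= u_radial f x.
Proof. by rewrite /u_radial; case: ifP => // _; exact: powR_ge0. Qed.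

Lemma u_radialX x : x != 0 -> u_radial f x ^+ n = A x / B x.
Proof.
move=> x0; rewrite /u_radial (negbTE x0) -/(A x) -/(B x).
rewrite -powR_mulrn ?powR_ge0// -powRrM mulVf ?gt_eqF// powRr1//.
by rewrite divr_ge0 ?radialA_ge0// ltW// radialB_gt0.
Qed.

Lemma u_radial_le1 x : u_radial f x <= 1.
Proof.
have [->|x0] := eqVneq x 0; first by rewrite /u_radial eqxx.
rewrite -(ler_pXn2r n0) ?nnegrE ?u_radial_ge0// u_radialX// expr1n.
rewrite ler_pdivrMr ?radialB_gt0// mul1r -lee_fin -radial_intAE// -radial_intBE//.
exact: radial_int_le.
Qed.

Lemma u_radial_le x b : x != 0 -> 0 < b -> b ^+ n * f 0 <= n%:R * B x ->
  u_radial f x <= M / b.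
Proof.
move=> x0 b0 hb; have M0 : 0 < M by exact: expR_gt0.
rewrite -(ler_pXn2r n0) ?nnegrE ?u_radial_ge0 ?divr_ge0 ?(ltW b0) ?(ltW M0)//.
rewrite u_radialX// ler_pdivrMr ?radialB_gt0//.
rewrite -(ler_pM2l nn) expr_div_n; apply: le_trans (radialA_le x0) _.
rewrite mulrCA mulrAC -mulrA -mulrA ler_wpM2l ?exprn_ge0 ?(ltW M0)//.
by rewrite mulrA ler_pdivlMr ?exprn_gt0// mulrC.
Qed.

(** With [b = c rho / (2 e)], the point [b x] is the midpoint of [2 b y] and [c rho z], at both of
    which [f] is at least [f 0 e^(-2n)]. This bounds [B x] below, and [u_radial_le] applies with
    [e^(-2) b]. *)
Lemma u_radial_near x y z c rho e : x != 0 -> 0 < rho -> 0 < e -> 0 < c <= 1 ->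
  x = y + e *: z ->
  f 0 * expR (- (2 * n%:R)) <= f (rho *: z) ->
  (forall s, 0 <= s <= c * (rho / e) -> f 0 * expR (- (2 * n%:R)) <= f (s *: y)) ->
  u_radial f x <= 2 * M * expR 2 / c * (e / rho).
Proof.
move=> x0 r0 e0 /andP[c0 c1] xE hz hy.
set q := f 0 * _ in hz hy; have q0 : 0 <= q by rewrite mulr_ge0 ?expR_ge0// ltW.
have qf : q <= f 0.
  by rewrite /q ger_pMr// -[leRHS]expR0 ler_expR oppr_le0 mulr_ge0.
pose b := c * (rho / e) / 2; have b0 : 0 < b by rewrite !divr_gt0// mulr_gt0// divr_gt0.
have h01 : 0 <= (2^-1 : R) <= 1 by apply/andP; split; lra.
have hb : q <= f (b *: x).
  have -> : b *: x = (1 - 2^-1) *: ((2 * b) *: y) + 2^-1 *: ((1 - c) *: 0 + c *: (rho *: z)).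
    rewrite xE; apply/rowP => i; rewrite !mxE /b; field.
    by rewrite gt_eqF.
  apply: (log_concave_ge_min lcf q0 h01).
    apply: hy; rewrite mulr_ge0 ?(ltW b0)//= /b.
    by rewrite mulrC divfK.
  by apply: (log_concave_ge_min lcf q0) => //; rewrite (ltW c0).
have be : 0 < expR (- 2) * b by rewrite mulr_gt0 ?expR_gt0.
apply: le_trans (u_radial_le x0 be _) _.
  apply: le_trans (radialB_lower x0 b0).
  have -> : (expR (- 2) * b) ^+ n * f 0 = q * b ^+ n.
    rewrite exprMn -expRM_natl /q (_ : n%:R * - 2 = - (2 * n%:R)); last by ring.
    by ring.
  by rewrite ler_wpM2r ?exprn_ge0 ?(ltW b0)// le_min qf.
rewrite expRN /b le_eqVlt; apply/orP; left; apply/eqP; field.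
by rewrite !gt_eqF ?expR_gt0.
Qed.

(** The point is a convex combination of [s y] and [rho z] with weight [t = d s / (1 + d s) <= d s]
    on the latter; [ln f] at the two ends differs unfavourably by at most [(2 + kap) n]. *)
Lemma ray_compare x y z rho e s : 0 < rho -> 0 < e -> x = y + e *: z ->
  f 0 * expR (- (2 * n%:R)) <= f (rho *: z) -> 0 <= s ->
  f (s *: y) * expR (- ((2 + kap) * n%:R * (e / rho)) * s)
    <= f ((s / (1 + e / rho * s)) *: x).
Proof.
move=> r0 e0 xE hz s0; set d := e / rho.
have d0 : 0 < d by rewrite divr_gt0.
have ds0 : 0 <= d * s by rewrite mulr_ge0// ltW.
have v0 : 0 < 1 + d * s by lra.
have := f0 (s *: y); rewrite le_eqVlt => /predU1P[<-|fy]; first by rewrite mul0r.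
pose t := d * s / (1 + d * s).
have t0 : 0 <= t by rewrite divr_ge0// ltW.
have t01 : 0 <= t <= 1 by rewrite t0/= ler_pdivrMr// mul1r lerDr.
have tds : t <= d * s by rewrite ler_pdivrMr// ler_peMr// lerDl.
have -> : (s / (1 + d * s)) *: x = (1 - t) *: (s *: y) + t *: (rho *: z).
  rewrite xE; apply/rowP => i; rewrite !mxE /t /d; field.
  by rewrite !gt_eqF// ltr_pwDl// mulr_ge0// ltW.
apply: le_trans (proj2 lcf _ _ _ t01).
have fz : 0 < f (rho *: z).
  by apply: lt_le_trans hz; rewrite mulr_gt0 ?expR_gt0.
have fE : f (s *: y) `^ (1 - t) * f (rho *: z) `^ t =
    f (s *: y) * expR (t * (ln (f (rho *: z)) - ln (f (s *: y)))).
  transitivity (expR (ln (f (s *: y))) * expR (t * (ln (f (rho *: z)) - ln (f (s *: y))))).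
    by rewrite /powR !gt_eqF// -!expRD; congr (expR _); ring.
  by rewrite lnK ?posrE.
rewrite fE ler_pM2l// ler_expR.
have l1 : ln (f 0) - 2 * n%:R <= ln (f (rho *: z)).
  have : ln (f 0 * expR (- (2 * n%:R))) <= ln (f (rho *: z)).
    by rewrite ler_ln ?posrE// mulr_gt0 ?expR_gt0.
  by rewrite lnM ?posrE ?expR_gt0// expRK.
have l2 : ln (f (s *: y)) <= kap * n%:R + ln (f 0).
  have -> : kap * n%:R + ln (f 0) = ln (M ^+ n * f 0).
    by rewrite lnM ?posrE ?exprn_gt0 ?expR_gt0// -expRM_natl expRK mulrC.
  by rewrite ler_ln ?posrE// mulr_gt0 ?exprn_gt0 ?expR_gt0.
have l3 : - ((2 + kap) * n%:R) <= ln (f (rho *: z)) - ln (f (s *: y)) by lra.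
have l4 : t * - ((2 + kap) * n%:R) <= t * (ln (f (rho *: z)) - ln (f (s *: y))).
  by rewrite ler_wpM2l.
have kn : 0 <= (2 + kap) * n%:R by rewrite mulr_ge0// addr_ge0.
have : 0 <= (d * s - t) * ((2 + kap) * n%:R) by rewrite mulr_ge0// subr_ge0.
lra.
Qed.

(* The scale of the ray through [y], that is [f 0 ^ (- 1 / n) / normK f y]. *)
Let nu y := (n%:R * B y / f 0) `^ (n%:R)^-1.

Lemma nu_gt0 y : y != 0 -> 0 < nu y.
Proof. by move=> y0; rewrite powR_gt0// divr_gt0// mulr_gt0// radialB_gt0. Qed.

Lemma nuX y : y != 0 -> nu y ^+ n * f 0 = n%:R * B y.
Proof.
move=> y0; have B0 := radialB_gt0 y0.
rewrite -powR_mulrn ?powR_ge0// -powRrM mulVf ?gt_eqF// powRr1 ?divfK ?gt_eqF//.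
by rewrite divr_ge0 ?mulr_ge0 ?ltW.
Qed.

(** [2 + kap] comes from [ray_compare], and the other 2 from the Jacobian exponent
    [n + 1 <= 2 n]. *)
Let K1 := 4 + kap.
Let K10 : 0 < K1. Proof. by rewrite ltr_pwDl. Qed.

Let harmonic_rate_le d : 0 < d -> ((2 + kap) * n%:R + n.+1%:R) * d <= n%:R * (K1 * d).
Proof.
move=> d0; rewrite mulrA ler_pM2r// /K1 -(addn1 n) natrD.
have : 1 <= n%:R :> R by rewrite (ler_nat R 1 n).
lra.
Qed.

Lemma radialA_compare x y z rho e : x != 0 -> y != 0 -> 0 < rho -> 0 < e ->
  y = x + e *: z -> f 0 * expR (- (2 * n%:R)) <= f (rho *: z) ->
  A x <= expR (n%:R * (K1 * (e / rho))) * A y.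
Proof.
move=> x0 y0 r0 e0 yE hz; set d := e / rho; have d0 : 0 < d by rewrite divr_gt0.
set K := n%:R * _; have K0 : 0 <= K by rewrite mulr_ge0// mulr_ge0// ltW.
rewrite -ler_pdivrMl ?expR_gt0// -expRN -lee_fin EFinM -(radial_intAE x0) -(radial_intAE y0).
have D01 s : (`[0%R, 1%R]%classic : set R) s -> 0 <= s /\ (`[0%R, 1%R]%classic : set R) (s / (1 + d * s)).
  rewrite /= !in_itv/= => /andP[s0 s1]; split=> //.
  have v1 : 1 <= 1 + d * s by rewrite lerDl mulr_ge0// ltW.
  have v0 : 0 < 1 + d * s by exact: lt_le_trans v1.
  by rewrite divr_ge0 ?(ltW v0)//= ler_pdivrMr// mul1r (le_trans s1).
apply: le_trans (radial_harmonic n0 (lh y) (lh x) d0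
  (fun s => @ray_compare _ _ _ _ _ s r0 e0 yE hz) (measurable_itv _) D01).
rewrite -ge0_integralZl//; last 2 first.
- exact: (measurable_radial (lh x)).
- by move=> r; rewrite /= in_itv/= => /andP[r1 _]; rewrite lee_fin mulr_ge0// exprn_ge0.
apply: ge0_le_integral => //.
- move=> r; rewrite /= in_itv/= => /andP[r1 _].
  by rewrite -EFinM lee_fin !mulr_ge0 ?expR_ge0// exprn_ge0.
- by apply: emeasurable_funM => //; exact: (measurable_radial (lh x)).
- have := emeasurable_funM (@measurable_radial R _ (lh x) n.-1 `[0%R, 1%R]%classic)
    (@measurable_expRM R (- (((2 + kap) * n%:R + n.+1%:R) * d)) `[0%R, 1%R]%classic).
  by apply: eq_measurable_fun => r _; rewrite EFinM.
- move=> r; rewrite /= in_itv/= => /andP[r1 r2].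
  rewrite -EFinM lee_fin mulrC ler_wpM2l ?mulr_ge0 ?exprn_ge0//.
  rewrite ler_expR mulNr lerN2.
  apply: le_trans (harmonic_rate_le d0); rewrite ler_piMr// mulr_ge0 ?(ltW d0)//.
  by rewrite addr_ge0// mulr_ge0// addr_ge0.
Qed.

(** On the half-line the loss is unbounded; [radial_tilt] replaces [r] by the bound [3 e^4 nu y] on
    its mean. *)
Lemma radialB_compare x y z rho e : x != 0 -> y != 0 -> 0 < rho -> 0 < e ->
  x = y + e *: z -> f 0 * expR (- (2 * n%:R)) <= f (rho *: z) ->
  expR (- (n%:R * (K1 * (e / rho) * (3 * expR 4 * nu y)))) * B y <= B x.
Proof.
move=> x0 y0 r0 e0 xE hz; set d := e / rho; have d0 : 0 < d by rewrite divr_gt0.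
set m := 3 * expR 4 * nu y.
have m0 : 0 <= m by rewrite !mulr_ge0 ?expR_ge0 ?powR_ge0.
set K := ((2 + kap) * n%:R + n.+1%:R) * d.
have K0 : 0 <= K by rewrite mulr_ge0 ?(ltW d0)// addr_ge0// mulr_ge0// addr_ge0.
have D0 s : (`[0%R, +oo[%classic : set R) s -> 0 <= s /\ (`[0%R, +oo[%classic : set R) (s / (1 + d * s)).
  rewrite /= !in_itv/= !andbT => s0; split=> //.
  by rewrite divr_ge0// addr_ge0// mulr_ge0// ltW.
have h1 := radial_harmonic n0 (lh x) (lh y) d0
  (fun s => @ray_compare _ _ _ _ _ s r0 e0 xE hz) (measurable_itv _) D0.
have hm : (\int[@lebesgue_measure R]_(r in `[0%R, +oo[) (r ^+ n * f (r *: y))%:E <= (m * B y)%:E)%E.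
  apply: (@radial_moment R n (fun r => f (r *: y)) n0 (lh y) _ (B y) (nu y)).
  - by rewrite h0E.
  - exact: radial_intBE.
  - exact: nu_gt0.
  - by rewrite h0E nuX.
have h2 := radial_tilt n0 (lh y) K0 m0 (radial_intBE y0) hm.
have := le_trans h2 h1; rewrite -/(radial_int f x `[0%R, +oo[) radial_intBE// lee_fin.
apply: le_trans; rewrite ler_wpM2r ?(ltW (radialB_gt0 y0))// ler_expR lerN2.
by rewrite [n%:R * _]mulrA ler_wpM2r// harmonic_rate_le.
Qed.

Lemma u_radial_compare x y z rho e : x != 0 -> y != 0 -> 0 < rho -> 0 < e ->
  x = y + e *: z -> f 0 * expR (- (2 * n%:R)) <= f (rho *: z) ->
  f 0 * expR (- (2 * n%:R)) <= f (rho *: - z) ->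
  u_radial f x <= u_radial f y * expR (K1 * (e / rho) * (1 + 3 * expR 4 * nu y)).
Proof.
move=> x0 y0 r0 e0 xE hz hNz; have yE : y = x + e *: - z.
  by rewrite xE scalerN addrK.
have Bx := radialB_gt0 x0; have By := radialB_gt0 y0.
rewrite -(ler_pXn2r n0) ?nnegrE ?mulr_ge0 ?u_radial_ge0 ?expR_ge0//.
have hA := radialA_compare x0 y0 r0 e0 yE hNz.
have hB := radialB_compare x0 y0 r0 e0 xE hz.
rewrite (u_radialX x0).
rewrite [leRHS]exprMn.
rewrite (u_radialX y0).
rewrite -expRM_natl.
rewrite (ler_pdivrMr _ _ Bx).
move: (e / rho) (3 * expR 4 * nu y) hA hB => d m hA.
rewrite expRN ler_pdivrMl ?expR_gt0// => hB.
have -> : A y / B y * expR (n%:R * (K1 * d * (1 + m))) * B x =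
    expR (n%:R * (K1 * d)) * A y * (expR (n%:R * (K1 * d * m)) * B x / B y).
  have -> : n%:R * (K1 * d * (1 + m)) = n%:R * (K1 * d) + n%:R * (K1 * d * m) by ring.
  by rewrite expRD; ring.
apply: le_trans hA _; rewrite ler_peMr ?mulr_ge0 ?expR_ge0 ?radialA_ge0//.
by rewrite ler_pdivlMr// mul1r.
Qed.

(** Chosen so that [s <= 1 / (E4 d)] and [nu y > 1 / (12 e^4 K1 d)] give [3 M s <= nu y], the
    hypothesis of [radial_level]. *)
Let E4 := 36 * expR 4 * K1 * M.
Let C0 := increment_const kap.

Lemma u_radial_increment x y z rho e : x != 0 -> 0 < rho -> 0 < e ->
  x = y + e *: z -> f 0 * expR (- (2 * n%:R)) <= f (rho *: z) ->
  f 0 * expR (- (2 * n%:R)) <= f (rho *: - z) ->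
  u_radial f x - u_radial f y <= C0 * (e / rho).
Proof.
move=> x0 r0 e0 xE hz hNz; have [d dE] : exists d, e / rho = d by exists (e / rho).
rewrite dE; have d0 : 0 < d by rewrite -dE divr_gt0.
have M0 : 0 < M by exact: lt_le_trans M1.
have e41 : 1 <= expR 4 :> R by rewrite -expR0 ler_expR.
have E2 : 0 < expR 2 :> R by exact: expR_gt0.
have E40 : 0 < expR 4 :> R by exact: expR_gt0.
have E1 : 1 <= E4.
  have h1 : 1 <= K1 by rewrite /K1; move: kap0; lra.
  have h2 : 1 <= 36 * expR 4 :> R by lra.
  by rewrite /E4 (mulr_ege1 (mulr_ege1 h2 h1)).
have E0 : 0 < E4 by exact: lt_le_trans E1.
have T1 : 0 <= 2 * K1 * (1 + 3 * expR 4 * M) * d.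
  rewrite (mulr_ge0 _ (ltW d0))// (mulr_ge0 (mulr_ge0 _ (ltW K10)))// addr_ge0//.
  by rewrite (mulr_ge0 _ (ltW M0))// mulr_ge0// ltW.
have T2 : 0 <= 4 * K1 * d by rewrite !mulr_ge0 ?(ltW d0) ?(ltW K10).
have T3 : 0 <= 2 * M * expR 2 * E4 * d 
  by rewrite (mulr_ge0 (mulr_ge0 _ (ltW E0)) (ltW d0))// !mulr_ge0 ?expR_ge0.
have T4 : 0 <= 2 * M * expR 2 * d 
  by rewrite (mulr_ge0 _ (ltW d0))// !mulr_ge0 ?expR_ge0.
have -> : C0 * d = 2 * K1 * (1 + 3 * expR 4 * M) * d + 4 * K1 * d +
  2 * M * expR 2 * E4 * d + 2 * M * expR 2 * d by rewrite /C0 /increment_const -/K1 -/M -/E4; ring.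
apply: le_sum4 => //.
have q0 : f 0 * expR (- (2 * n%:R)) <= f 0.
  by rewrite ger_pMr// -[leRHS]expR0 ler_expR oppr_le0 mulr_ge0.
have uy0 := u_radial_ge0 y.
have uxy : u_radial f x - u_radial f y <= u_radial f x by rewrite gerBl.
have [y0|y0] := eqVneq y 0.
  have c1 : 0 < (1 : R) <= 1 by rewrite ltr01 lexx.
  have := @u_radial_near x y z 1 rho e x0 r0 e0 c1 xE hz.
  rewrite divr1 dE => h; apply: Or44; apply: le_trans uxy _.
  by apply: h => s _; rewrite y0 scaler0.
have n1 := nu_gt0 y0.
have un : nu y * u_radial f y <= M.
  rewrite mulrC -ler_pdivlMr//; apply: u_radial_le => //; by rewrite nuX.
have [eta1|eta1] := leP (K1 * d * (1 + 3 * expR 4 * nu y)) 2^-1.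
  have := u_radial_compare x0 y0 r0 e0 xE hz hNz; rewrite dE => h.
  apply: Or41; apply: (@increment_exp R _ _ (nu y)) => //.
  - by rewrite uy0 u_radial_le1.
  - exact: ltW.
(* If [K1 * d] exceeds 1/4, then [u <= 1] is already at most [4 K1 d]; otherwise the rest of the
   exponent exceeds 1/4 and [nu y] is large. *)
have [Kd|Kd] := ltP 4^-1 (K1 * d).
  apply: Or42; apply: le_trans uxy _; apply: le_trans (u_radial_le1 x) _.
  by rewrite -mulrA -ler_pdivrMl// mulr1 ltW.
have md : 4^-1 < K1 * d * (3 * expR 4 * nu y).
  by apply: lt_quarter Kd; rewrite mulrDr mulr1 in eta1.
have c01 := invr_ge1_itv E1.
have := @u_radial_near x y z E4^-1 rho e x0 r0 e0 c01 xE hz.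
rewrite invrK dE => h; have {}h := h _.
apply: Or43; apply: le_trans uxy (h _) => s /andP[s0 s1].
have [->|sn0] := eqVneq s 0; first by rewrite scale0r.
have {}s0 : 0 < s by rewrite lt_neqAle eq_sym sn0.
have := @radial_level R n (fun r => f (r *: y)) n0 (lh y) (h00 y) M s M1.
rewrite h0E; apply=> //.
rewrite -/(radial_int f y `[0%R, +oo[) radial_intBE// -EFinM lee_fin -nuX//.
rewrite ler_wpM2r// ?(ltW f00)// lerXn2r ?nnegrE ?mulr_ge0 ?(ltW n1) ?(ltW s0) ?(ltW M0)//.
have s2 : E4 * (s * d) <= 1.
  rewrite -ler_pdivlMl// mulr1 -ler_pdivlMr//.
  by rewrite -dE invf_div.
have P0 : 0 < 12 * expR 4 * (K1 * d) by rewrite !mulr_gt0.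
rewrite -(ler_pM2l P0).
have -> : 12 * expR 4 * (K1 * d) * (3 * M * s) = E4 * (s * d) by rewrite /E4; ring.
have -> : 12 * expR 4 * (K1 * d) * nu y = 4 * (K1 * d * (3 * expR 4 * nu y)) by ring.
by apply: le_trans s2 _; rewrite -ler_pdivrMl// mulr1 ltW.
Qed.

(** The norm bound says [n * B w >= 1], and the choice of [rho] puts [(3 M rho)^n f 0] below 1, so
    [radial_level] applies. *)
Lemma normK_level w rho : w != 0 -> 0 < rho ->
  3 * M * rho * f 0 `^ (n%:R)^-1 <= 1 -> normK f w <= 1 ->
  f 0 * expR (- (2 * n%:R)) <= f (rho *: w).
Proof.
move=> w0 r0 hr; rewrite /normK (negbTE w0) -/(B w) powRN => hw.
have nB : 0 < n%:R * B w by rewrite mulr_gt0// radialB_gt0.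
have M0 : 0 < M by exact: expR_gt0.
have nB1 : 1 <= n%:R * B w.
  have h1 : 1 <= (n%:R * B w) `^ n%:R^-1.
    by move: hw; rewrite invf_le1// powR_gt0.
  have -> : n%:R * B w = ((n%:R * B w) `^ n%:R^-1) ^+ n.
    by rewrite -powR_mulrn ?powR_ge0// -powRrM mulVf ?gt_eqF// powRr1// ltW.
  exact: exprn_ege1.
have := @radial_level R n (fun r => f (r *: w)) n0 (lh w) (h00 w) M rho M1.
rewrite h0E; apply=> //.
rewrite -/(radial_int f w `[0%R, +oo[) radial_intBE// -EFinM lee_fin.
apply: le_trans nB1.
have -> : f 0 = (f 0 `^ n%:R^-1) ^+ n.
  by rewrite -powR_mulrn ?powR_ge0// -powRrM mulVf ?gt_eqF// powRr1// ltW.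
by rewrite -exprMn exprn_ile1// !mulr_ge0 ?powR_ge0 ?(ltW M0) ?(ltW r0).
Qed.

Lemma u_radial_lip_one_sided x y w t : w != 0 -> 0 < t -> x = y + t *: w ->
  normK f w <= 1 -> normK f (- w) <= 1 ->
  u_radial f x - u_radial f y <= 3 * M * C0 * f 0 `^ (n%:R)^-1 * t.
Proof.
move=> w0 t0 xE hw hNw; have M0 : 0 < M by exact: expR_gt0.
have g0 : 0 < f 0 `^ (n%:R)^-1 by exact: powR_gt0.
have C00 : 0 < C0 by exact: increment_const_gt0.
have [x0|x0] := eqVneq x 0.
  have -> : u_radial f x = 0 by rewrite /u_radial x0 eqxx.
  rewrite sub0r; apply: (@le_trans _ _ 0); first by rewrite oppr_le0 u_radial_ge0.
  by rewrite (mulr_ge0 (mulr_ge0 (mulr_ge0 (mulr_ge0 _ (ltW M0)) (ltW C00)) (ltW g0)) (ltW t0)).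
set g := f 0 `^ _ in g0 *.
have r0 : 0 < (3 * M * g)^-1 by rewrite invr_gt0 (mulr_gt0 (mulr_gt0 _ M0) g0).
have rg : 3 * M * (3 * M * g)^-1 * g <= 1.
  by rewrite mulrAC divff// gt_eqF// (mulr_gt0 (mulr_gt0 _ M0) g0).
apply: le_trans (u_radial_increment x0 r0 t0 xE (normK_level w0 r0 rg hw)
  (normK_level _ r0 rg hNw)) _; first by rewrite oppr_eq0.
by rewrite invrK le_eqVlt; apply/orP; left; apply/eqP; ring.
Qed.

Lemma u_radial_lip x y t : x != y -> 0 < t -> Khat f (t^-1 *: (x - y)) ->
  `|u_radial f x - u_radial f y| <= 3 * M * C0 * f 0 `^ (n%:R)^-1 * t.
Proof.
move=> xy t0 [hw hNw]; rewrite /Kf/= in hw hNw; set w := _ *: _ in hw hNw.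
have tw : t *: w = x - y by rewrite scalerA divff ?gt_eqF// scale1r.
have w0 : w != 0 by rewrite scaler_eq0 invr_eq0 gt_eqF//= subr_eq0.
rewrite ler_norml lerNl opprB; apply/andP; split.
  apply: (@u_radial_lip_one_sided _ _ (- w)); rewrite ?oppr_eq0 ?opprK//.
  by rewrite scalerN tw opprB addrC subrK.
by apply: (@u_radial_lip_one_sided _ _ w) => //; rewrite tw addrC subrK.
Qed.

End radial_map.

Theorem theorem3 (R : realType) :
  exists C : R, 0 < C /\
  forall (n : nat) (f : 'rV[R]_n -> R),
    log_concave f ->
    (0 < iint (fun x => (f x)%:E))%E ->
    (iint (fun x => (f x)%:E) < +oo)%E ->
    barycenter_origin f ->
    forall x y : 'rV[R]_n, x != y ->
      `|u_radial f x - u_radial f y| / normKhat f (x - y)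
        <= C * f 0 `^ (n%:R)^-1.
Proof.
pose kap : R := 2 * expR 1.
have kap0 : 0 <= kap by rewrite mulr_ge0 ?expR_ge0.
exists (3 * expR kap * increment_const kap); split.
  by rewrite (mulr_gt0 _ (increment_const_gt0 kap0))// mulr_gt0 ?expR_gt0.
move=> n f lcf If0 Ify bf x y xy.
have [n0|n0] := posnP n; first by subst n; rewrite [x]thinmx0 [y]thinmx0 eqxx in xy.
have [d [m [d0 m0 hm]]] := origin_interior lcf If0 Ify bf.
have f00 : 0 < f 0 by apply: lt_le_trans m0 (hm _ (box_center _ d0)).
have fpos z : exists2 r, 0 < r & 0 < f (r *: z).
  have [t t0 ht] := absorb_box z d0; exists t^-1; rewrite ?invr_gt0//.
  exact: lt_le_trans m0 (hm _ ht).
have lip := u_radial_lip n0 lcf f00 kap0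
  (fun z => le_value_origin lcf If0 Ify bf z n0) fpos
  (fun z => @ray_decay _ _ _ lcf If0 Ify bf z n0) xy.
set c := 3 * _ * _ * _ in lip *.
have c0 : 0 < c.
  by rewrite mulr_gt0 ?powR_gt0// (mulr_gt0 _ (increment_const_gt0 kap0))// mulr_gt0 ?expR_gt0.
rewrite /normKhat; set S := [set t | _].
(* The infimum of the empty set is 0 and so is a quotient by 0; the same convention settles a zero
   infimum below. *)
have [S0|/set0P Sn] := eqVneq S set0; first by rewrite S0 inf0 invr0 mulr0 ltW.
have hS : `|u_radial f x - u_radial f y| / c <= inf S.
  by apply: lb_le_inf => // t [t0 ht]; rewrite ler_pdivrMr// mulrC lip.
have : 0 <= inf S by apply: lb_le_inf => // t [t0 _]; exact: ltW.
rewrite le_eqVlt => /predU1P[<-|i0]; first by rewrite invr0 mulr0 ltW.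
by rewrite ler_pdivrMr// mulrC -ler_pdivrMr.
Qed.
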